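(* Let $S$ be a finite set and let $M=(M(a,b))_{a,b\in S}$ be a $\{0,1\}$-valued $(S\times S)$-matrix that is primitive, i.e. there is $n>0$ with $M^n(a,b)>0$ for all $a,b\in S$. Let $X_M=\{x=(x_i)_{i\in\mathbb Z}\in S^{\mathbb Z}\mid M(x_i,x_{i+1})>0\text{ for all }i\in\mathbb Z\}$ and let $T$ be the two-sided shift on $X_M$. Let $(\pi_n)_{n\in\mathbb Z}$ be a sequence of probability measures on $S$ and $(P_n)_{n\in\mathbb Z}$ a sequence of row-stochastic $(S\times S)$-matrices such that $\pi_nP_n=\pi_{n+1}$ for each $n\in\mathbb Z$, and $P_n(a,b)>0$ if and only if $M(a,b)=1$, for each $n\in\mathbb Z$. Let $\mu$ be the Markov measure on $X_M$ generated by $(\pi_n,P_n)_{n\in\mathbb Z}$. Suppose that $$\delta:=\inf\{P_n(a,b)\mid n\in\mathbb Z,\ M(a,b)=1\}>0.$$ If the shift $T$ on $(X_M,\mu)$ is nonsingular and conservative, then $T$ is weakly mixing.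
   Context: For integers $i\le j$ and $a=(a_l)_{i\le l\le j}$ in $S$ with $M(a_l,a_{l+1})=1$ for $l=i,\dots,j-1$, put $[a]_i^j=\{x\in X_M\mid x_l=a_l,\ l=i,\dots,j\}$. The Markov measure generated by $(\pi_n,P_n)_{n\in\mathbb Z}$ is the unique probability measure $\mu$ on $X_M$ with $\mu([a]_i^j)=\pi_i(a_i)P_i(a_i,a_{i+1})\cdots P_{j-1}(a_{j-1},a_j)$ for every such cylinder. An invertible Borel transformation $T$ of $(Y,\nu)$ is nonsingular if $\nu\circ T\sim\nu$ (same null sets). It is conservative if for every measurable $B$ with $\nu(B)>0$ and a.e. $y\in B$, the set $\{n\in\mathbb Z:T^ny\in B\}$ is infinite. It is ergodic if every $T$-invariant measurable set is null or conull. It is weakly mixing if for each ergodic measure preserving invertible transformation $R$ of a standard probability space, $T\times R$ is ergodic (with respect to the product measure). *)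

(* Defs.v *)
From HB Require Import structures.
From mathcomp Require Import all_boot all_order all_algebra.
From mathcomp Require Import all_classical all_reals all_analysis.

Set Implicit Arguments.
Unset Strict Implicit.
Unset Printing Implicit Defensive.

Import Order.TTheory GRing.Theory Num.Theory.

Local Open Scope classical_set_scope.
Local Open Scope ring_scope.

Record borel_aut d (Y : measurableType d) := BorelAut {
  aut_fun :> Y -> Y ;
  aut_inv : Y -> Y ;
  aut_funK : cancel aut_fun aut_inv ;
  aut_invK : cancel aut_inv aut_fun ;
  measurable_aut : measurable_fun [set: Y] aut_fun ;
  measurable_aut_inv : measurable_fun [set: Y] aut_inv }.

(* T^n for n in Z; [Negz k] is the integer -(k+1). *)
Definition aut_iter d (Y : measurableType d) (T : borel_aut Y) (n : int) :
    Y -> Y :=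
  match n with
  | Posz k => iter k T
  | Negz k => iter k.+1 (aut_inv T)
  end.

Section ProdAut.
Context d1 d2 (Y : measurableType d1) (Z : measurableType d2).
Variables (T : borel_aut Y) (Q : borel_aut Z).

Let f (p : Y * Z) : Y * Z := (T p.1, Q p.2).
Let g (p : Y * Z) : Y * Z := (aut_inv T p.1, aut_inv Q p.2).

Let fK : cancel f g.
Proof. by case=> y z; rewrite /f /g /= !aut_funK. Qed.

Let gK : cancel g f.
Proof. by case=> y z; rewrite /f /g /= !aut_invK. Qed.

Let mf : measurable_fun [set: Y * Z] f.
Proof.
apply: measurable_fun_pair.
  exact: (measurableT_comp (measurable_aut T)).
exact: (measurableT_comp (measurable_aut Q)).
Qed.

Let mg : measurable_fun [set: Y * Z] g.
Proof.
apply: measurable_fun_pair.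
  exact: (measurableT_comp (measurable_aut_inv T)).
exact: (measurableT_comp (measurable_aut_inv Q)).
Qed.

Definition prod_aut : borel_aut (Y * Z)%type := BorelAut fK gK mf mg.

End ProdAut.

Section Dynamics.
Context d (Y : measurableType d) (R : realType).
Implicit Types (nu : {measure set Y -> \bar R}) (T : borel_aut Y).

(* nu \o T is the measure A |-> nu (T A). *)
Definition nonsingular nu T :=
  forall A : set Y, measurable A -> nu (T @` A) = 0%E <-> nu A = 0%E.

Definition conservative nu T :=
  forall B : set Y, measurable B -> (0 < nu B)%E ->
    {ae nu, forall y, B y -> infinite_set [set n : int | B (aut_iter T n y)]}.

Definition ergodic nu T :=
  forall A : set Y, measurable A -> T @^-1` A = A ->
    nu A = 0%E \/ nu (~` A) = 0%E.

Definition measure_preserving nu T :=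
  forall A : set Y, measurable A -> nu (T @^-1` A) = nu A.

(* A Hausdorff complete pseudometric space is a complete metric space, so the
   spaces [V] below are the Polish spaces; [Y] is required to be isomorphic,
   as a measurable space, to [V] with its Borel sigma-algebra. *)
Definition standard_borel :=
  exists V : completePseudoMetricType R,
    [/\ hausdorff_space V,
        exists2 D : set V, countable D & dense D
      & exists2 h : Y -> V, bijective h &
          forall A : set Y, measurable A <-> <<s @open V >> (h @` A)].

End Dynamics.
Arguments standard_borel {d} Y R.

Definition weakly_mixing d (Y : measurableType d) (R : realType)
    (nu : probability Y R) (T : borel_aut Y) :=
  forall (d' : measure_display) (Z : measurableType d') (m : probability Z R)
    (Q : borel_aut Z),
    standard_borel Z R -> measure_preserving m Q -> ergodic m Q ->
    ergodic (nu \x m)%E (prod_aut T Q).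

(* [M : rel S] is a {0,1}-valued matrix, the coercion bool >-> nat giving its
   entries; [adj_mx M] is the same matrix with rows and columns numbered by
   [enum_rank]. *)
Definition adj_mx (S : finType) (M : rel S) : 'M[nat]_#|S| :=
  \matrix_(i, j) (M (enum_val i) (enum_val j) : nat).

Definition primitive (S : finType) (M : rel S) :=
  exists2 n : nat, (0 < n)%N &
    forall a b : S, (0 < (adj_mx M ^+ n) (enum_rank a) (enum_rank b))%N.

Definition shift_space (S : finType) (M : rel S) : set (int -> S) :=
  [set x | forall i : int, M (x i) (x (i + 1))].

Section ShiftSpaceNonempty.
Variables (S : finType) (M : rel S).
Hypotheses (S0 : (0 < #|S|)%N) (prM : primitive M).

Let adjE a b : adj_mx M (enum_rank a) (enum_rank b) = M a b :> nat.
Proof. by rewrite mxE !enum_rankK. Qed.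

Let succ_ex a : exists b, M a b.
Proof.
have [[//|n] _ /(_ a a)] := prM; rewrite exprS -mulmxE mxE.
apply: contraPP => /forallNP nM; rewrite big1// => j _.
by rewrite -(enum_valK j) adjE (negbTE (introN idP (nM _))) mul0r.
Qed.

Let pred_ex a : exists b, M b a.
Proof.
have [[//|n] _ /(_ a a)] := prM; rewrite exprSr -mulmxE mxE.
apply: contraPP => /forallNP nM; rewrite big1// => j _.
by rewrite -(enum_valK j) adjE (negbTE (introN idP (nM _))) mulr0.
Qed.

Lemma shift_space_nonempty : exists x : int -> S, x \in shift_space M.
Proof.
have [a _] : exists a : S, a \in S by apply/card_gt0P.
have [f Mf] := choice succ_ex; have [g Mg] := choice pred_ex.
exists (fun i : int =>
  match i with Posz k => iter k f a | Negz k => iter k.+1 g a end).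
rewrite inE => -[k|[|k]] /=.
- by rewrite addn1; exact: Mf.
- exact: Mg.
- by rewrite subn1; exact: Mg.
Qed.

End ShiftSpaceNonempty.

(* A library measurable type is pointed, so X_M is formed from the data that
   make it nonempty: S nonempty and M primitive. *)
Definition markov_shift (S : finType) (M : rel S) (S0 : (0 < #|S|)%N)
  (prM : primitive M) : Type := {x : int -> S | x \in shift_space M}.

Section MarkovShift.
Variables (S : finType) (M : rel S).
Variables (S0 : (0 < #|S|)%N) (prM : primitive M).
Local Notation X := (markov_shift S0 prM).

HB.instance Definition _ := gen_eqMixin X.
HB.instance Definition _ := gen_choiceMixin X.
HB.instance Definition _ := isPointed.Build X
  (let: exist x hx := cid (shift_space_nonempty S0 prM) in exist _ x hx).

(* The word a_i ... a_j is the restriction to [i, j] of [a]: its values outside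
   [i, j] are irrelevant. *)
Definition admissible (i j : int) (a : int -> S) :=
  forall l : int, i <= l -> l < j -> M (a l) (a (l + 1)).

Definition cylinder (i j : int) (a : int -> S) : set X :=
  [set x | forall l : int, i <= l -> l <= j -> sval x l = a l].

Definition cylinders : set (set X) :=
  [set C | exists i j a, [/\ i <= j, admissible i j a & C = cylinder i j a]].

HB.instance Definition _ := @isMeasurable.Build (sigma_display cylinders) X
  <<s cylinders >> (@sigma_algebra0 _ setT cylinders) (@sigma_algebraC _ _)
  (@sigma_algebra_bigcup _ setT cylinders).

Lemma measurable_cylinder i j a : i <= j -> admissible i j a ->
  measurable (cylinder i j a).
Proof. by move=> ij aM; apply: sub_sigma_algebra; exists i, j, a. Qed.

Let shiftP (k : int) (x : X) :
  (fun i : int => sval x (i + k)) \in shift_space M.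
Proof.
by case: x => x /=; rewrite !inE => xM i; rewrite addrAC; exact: xM.
Qed.

Let shift_by (k : int) (x : X) : X :=
  exist (fun y => y \in shift_space M) _ (shiftP k x).

Let shift_byK k k' : k + k' = 0 -> cancel (shift_by k) (shift_by k').
Proof.
move=> kk' x; apply: eq_sig_hprop => /=.
  by move=> ? ? ?; exact: bool_irrelevance.
apply/funext => i /=.
by rewrite -addrA (addrC k') kk' addr0.
Qed.

Let measurable_shift_by k : measurable_fun [set: X] (shift_by k).
Proof.
apply: (@measurability _ _ _ _ _ _ cylinders) => //.
move=> _ [_ [i [j [a [ij aM ->]]]] <-]; rewrite setTI.
rewrite (_ : _ @^-1` _ = cylinder (i + k) (j + k) (fun l => a (l - k))).
  apply: measurable_cylinder; first by rewrite lerD2r.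
  move=> l il lj; rewrite addrAC; apply: aM; first by rewrite lerBrDr.
  by rewrite ltrBlDr.
apply/seteqP; split=> x /= xa l il lj.
  by rewrite -xa ?lerBrDr ?lerBlDr//= subrK.
by have := xa (l + k); rewrite !lerD2r addrK; exact.
Qed.

(* (T x)_i = x_(i+1) *)
Definition left_shift : borel_aut X :=
  BorelAut (shift_byK (subrr 1)) (shift_byK (addNr 1))
    (measurable_shift_by 1) (measurable_shift_by (- 1)).

End MarkovShift.

Definition prob_vector (S : finType) (R : realType) (p : S -> R) :=
  (forall a, 0 <= p a) /\ \sum_a p a = 1.

Definition row_stochastic (S : finType) (R : realType) (p : S -> S -> R) :=
  forall a, prob_vector (p a).

Definition markov_measure (S : finType) (M : rel S) (S0 : (0 < #|S|)%N)
    (prM : primitive M) (R : realType) (pi_ : int -> S -> R)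
    (P : int -> S -> S -> R) (mu : probability (markov_shift S0 prM) R) :=
  forall (i j : int) (a : int -> S), i <= j -> admissible M i j a ->
    mu (cylinder i j a) =
    (pi_ i (a i) *
      \prod_(k < `|j - i|%N) P (i + k%:Z) (a (i + k%:Z)) (a (i + k%:Z + 1)))%:E.

(* Main.v *)
Require Import Defs.
From HB Require Import structures.
From mathcomp Require Import all_boot all_order all_algebra.
From mathcomp Require Import all_classical all_reals all_analysis.
From mathcomp Require Import measurable_realfun.
From mathcomp Require Import ring lra zify.

Set Implicit Arguments.
Unset Strict Implicit.
Unset Printing Implicit Defensive.

Import Order.TTheory GRing.Theory Num.Theory.

Local Open Scope classical_set_scope.
Local Open Scope ring_scope.

(** Write nu for the product of mu with an invariant probability m of an ergodic
    automorphism Q of Z, and let A be invariant under T x Q.  The theorem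
    follows from two properties of A.

    First, A does not see finitely many coordinates of x.  Let a swap exchange
    two words u and v of the same length that begin and end with the same
    letters.  Conjugating a swap by T^n gives a swap at another place, and
    delta bounds the cost of a swap in terms of its length only
    ([swap_bound]); hence the densities w_n of mu o T^n with respect to mu
    change by a bounded factor, uniformly in n, when x is replaced by its swap
    ([weight_exchange]).  Suppose that a swap moved a non-null part of A out
    of A.  Approximate A by a set D that depends on finitely many coordinates
    of x.  By Hopf's maximal inequality ([maximal_ineq]), for most y in that
    part the orbits of y and of its swap spend little time, measured with
    weights w_n, in the symmetric difference of A and D; so the orbit of y is
    mostly in D and that of its swap mostly outside.  But after a finite time
    D does not distinguish the two orbits, while the total weight of an orbit
    is infinite because T is conservative ([weight_diverge]): a contradiction
    ([hopf_exchange], [invariant_swap]).  Both the densities and the divergence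
    pass from T to T x Q, because m is invariant and the densities depend on x
    alone ([prod_jacobian], [prod_diverge]).

    Second, such a set is independent of the words in the middle of x, up to a
    constant.  Any word b can be put in the place of the middle of x and
    connected on both sides to the rest of x by paths of a fixed length N,
    because M is primitive; the swaps that do this show
    nu (A cap ([b] x F)) >= delta^(2N) mu [b] nu (A cap (X x F))
    ([ball_independence]).  This inequality between measures extends from
    cylinders to all sets ([le_measure_ball]).  On the complement of A it says
    that the fibres of the complement are null over almost every z charged by
    A; as the set of z with non-null fibre is Q-invariant, ergodicity of Q
    concludes ([ergodic_dichotomy]). *)

(** * Weighted orbit sums and Hopf's maximal inequality *)

Section Weights.
Context d (Y : measurableType d) (R : realType).
Variables (T : Y -> Y) (w : Y -> R).

Definition weight (k : nat) (y : Y) : R := \prod_(j < k) w (iter j T y).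

Definition wsum (n : nat) (f : Y -> R) (y : Y) : R :=
  \sum_(k < n) weight k y * f (iter k T y).

Lemma weightS k y : weight k.+1 y = w y * weight k (T y).
Proof.
rewrite /weight big_ord_recl; congr (_ * _).
by apply: eq_bigr => j _; rewrite -iterSr.
Qed.

Lemma wsumS n f y : wsum n.+1 f y = f y + w y * wsum n f (T y).
Proof.
rewrite /wsum big_ord_recl /weight big_ord0 mul1r; congr (_ + _).
rewrite big_distrr/=; apply: eq_bigr => k _.
by rewrite -[X in X * _]/(weight k.+1 y) weightS mulrA -iterSr.
Qed.

Hypothesis w0 : forall y, 0 <= w y.

Lemma weight_ge0 k y : 0 <= weight k y.
Proof. by apply: prodr_ge0 => j _; exact: w0. Qed.

End Weights.

(** [w] is the density of the measure A |-> nu (T A) with respect to nu.  The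
    change of variables for nonnegative functions is taken as the definition,
    because in this form it iterates and passes to products. *)
Definition has_jacobian d (Y : measurableType d) (R : realType)
    (nu : {measure set Y -> \bar R}) (T : Y -> Y) (w : Y -> R) :=
  [/\ measurable_fun setT w, forall y, 0 <= w y &
    forall f : Y -> \bar R, measurable_fun setT f -> (forall y, (0 <= f y)%E) ->
      (\int[nu]_y ((w y)%:E * f (T y)) = \int[nu]_y f y)%E].

(** The largest of the sums [wsum k (fun y => g y - lam)] for k <= n, the value
    0 for k = 0 included.  The recursion replaces the manipulation of maxima in
    Garsia's proof of the maximal inequality. *)
Fixpoint hopf_max Y (R : realType) (T : Y -> Y) (w g : Y -> R) (lam : R)
    (n : nat) (y : Y) : R :=
  if n is n'.+1 then
    Num.max 0 (g y - lam + w y * hopf_max T w g lam n' (T y))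
  else 0.

Section Maximal.
Context d (Y : measurableType d) (R : realType).
Variables (nu : probability Y R) (T : Y -> Y) (w : Y -> R).
Hypotheses (mT : measurable_fun setT T) (jw : has_jacobian nu T w).

Let mw : measurable_fun setT w. Proof. by case: jw. Qed.
Let w0 y : 0 <= w y. Proof. by case: jw => _ + _; exact. Qed.

Lemma measurable_iter k : measurable_fun setT (iter k T).
Proof.
elim: k => [|k ih] /=; first exact: measurable_id.
exact: (measurableT_comp mT ih).
Qed.

Lemma measurable_weight k : measurable_fun setT (weight T w k).
Proof.
elim: k => [|k ih].
  rewrite (_ : weight _ _ _ = cst 1); first exact: measurable_cst.
  by apply/funext => y; rewrite /weight big_ord0.
rewrite (_ : weight _ _ _ = w \* (weight T w k \o T)).
  by apply: measurable_funM => //; exact: measurableT_comp.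
by apply/funext => y; rewrite weightS.
Qed.

Lemma measurable_wsum n f : measurable_fun setT f ->
  measurable_fun setT (wsum T w n f).
Proof.
move=> mf; apply: measurable_sum => k.
apply: measurable_funM; first exact: measurable_weight.
exact: (measurableT_comp mf (measurable_iter k)).
Qed.

Lemma integral_weight k (f : Y -> \bar R) :
  measurable_fun setT f -> (forall y, (0 <= f y)%E) ->
  (\int[nu]_y ((weight T w k y)%:E * f (iter k T y)) = \int[nu]_y f y)%E.
Proof.
move=> mf f0; elim: k => [|k ih].
  by apply: eq_integral => y _; rewrite /weight big_ord0 mul1e.
case: jw => _ _ jf.
rewrite -ih -(jf (fun y => (weight T w k y)%:E * f (iter k T y))%E).
- by apply: eq_integral => y _; rewrite weightS EFinM muleA -iterSr.
- apply: emeasurable_funM.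
    by apply/measurable_EFinP; exact: measurable_weight.
  exact: (measurableT_comp mf (measurable_iter k)).
- by move=> y; rewrite mule_ge0// lee_fin; exact: weight_ge0.
Qed.

Variables (g : Y -> R) (lam : R).
Hypotheses (mg : measurable_fun setT g) (g0 : forall y, 0 <= g y).
Hypothesis lam0 : 0 <= lam.

Let F := hopf_max T w g lam.

Let FS n y : F n.+1 y = Num.max 0 (g y - lam + w y * F n (T y)).
Proof. by []. Qed.

Let F0 n y : 0 <= F n y.
Proof. by case: n => // n; rewrite FS le_max lexx. Qed.

Let mF n : measurable_fun setT (F n).
Proof.
elim: n => [|n ih]; first exact: measurable_cst.
apply: measurable_maxr; first exact: measurable_cst.
apply: measurable_funD; first exact: measurable_funB.
by apply: measurable_funM => //; exact: (measurableT_comp ih mT).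
Qed.

Let F_ub n y : wsum T w n (fun y => g y - lam) y <= F n y.
Proof.
elim: n y => [|n ih] y; first by rewrite /wsum big_ord0.
by rewrite wsumS FS le_max lerD2l ler_wpM2l ?orbT.
Qed.

Let F_nd n y : F n y <= F n.+1 y.
Proof.
elim: n y => [|n ih] y; first exact: F0.
rewrite [leLHS]FS [leRHS]FS ge_max le_max lexx /=.
by rewrite le_max lerD2l ler_wpM2l ?orbT.
Qed.

Let P n := [set y | 0 < F n y].

Let mP n : measurable (P n).
Proof.
rewrite (_ : P n = F n @^-1` `]0, +oo[%classic); last first.
  by apply/seteqP; split=> y /=; rewrite /P/= in_itv/= andbT.
by rewrite -[X in measurable X]setTI; exact: mF.
Qed.

(* On the set where F (n + 1) is positive this is its recursion; elsewhere the
   left side vanishes. *)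
Let Fstep n y : F n.+1 y + lam * \1_(P n.+1) y <= g y + w y * F n (T y).
Proof.
rewrite indicE; have [|nP] := boolP (y \in P n.+1).
  rewrite inE /P /= FS lt_max ltxx /= => /ltW Gge0; rewrite max_r// mulr1.
  by rewrite addrAC subrK.
have -> : F n.+1 y = 0.
  apply/eqP; rewrite eq_le F0 andbT leNgt; apply/negP => h.
  by move/negP : nP; apply; rewrite inE.
by rewrite mulr0 addr0 addr_ge0// mulr_ge0.
Qed.

Hypothesis ig : (\int[nu]_y (g y)%:E < +oo)%E.

(* The transfer by w preserves integrals, so the last term of [Fstep] integrates
   to the integral of F n. *)
Let intF_step n : (\int[nu]_y (F n.+1 y)%:E + lam%:E * nu (P n.+1) <=
  \int[nu]_y (g y)%:E + \int[nu]_y (F n y)%:E)%E.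
Proof.
case: jw => _ _ jf.
have mEF k : measurable_fun setT (EFin \o F k) by apply/measurable_EFinP.
have m1P : measurable_fun setT (EFin \o \1_(P n.+1) : Y -> \bar R).
  by apply/measurable_EFinP; exact: measurable_indic.
have mlP : measurable_fun setT (fun y => lam%:E * (\1_(P n.+1) y)%:E)%E.
  exact: measurable_funeM.
have mEg : measurable_fun setT (EFin \o g) by apply/measurable_EFinP.
have mwF : measurable_fun setT (fun y => (w y)%:E * (F n (T y))%:E)%E.
  apply/measurable_EFinP; apply: measurable_funM => //.
  exact: (measurableT_comp (mF n) mT).
rewrite -(setIT (P n.+1)) -integral_indic// -ge0_integralZl//.
rewrite -(jf (EFin \o F n))//; last by move=> y; rewrite lee_fin.
have E0 y : (0 <= lam%:E * (\1_(P n.+1) y)%:E)%E by rewrite -EFinM lee_fin mulr_ge0.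
have E1 y : (0 <= (w y)%:E * (F n (T y))%:E)%E by rewrite -EFinM lee_fin mulr_ge0.
have EF k y : (0 <= (F k y)%:E)%E by rewrite lee_fin.
have Eg y : (0 <= (g y)%:E)%E by rewrite lee_fin.
rewrite -!ge0_integralD//; last exact: (mEF n.+1).
apply: ge0_le_integral => //.
- by move=> y _; rewrite adde_ge0.
- exact: (emeasurable_funD (mEF n.+1) mlP).
- exact: (emeasurable_funD mEg mwF).
- by move=> y _; rewrite -!EFinM -!EFinD lee_fin; exact: Fstep.
Qed.

Let intF n : (\int[nu]_y (F n y)%:E < +oo)%E.
Proof.
elim: n => [|n ih]; first by rewrite integral0.
have : (\int[nu]_y (g y)%:E + \int[nu]_y (F n y)%:E < +oo)%E.
  by rewrite lte_add_pinfty.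
by apply: le_lt_trans; apply: le_trans (intF_step n); rewrite leeDl// mule_ge0.
Qed.

Let maximal_step n : (lam%:E * nu (P n) <= \int[nu]_y (g y)%:E)%E.
Proof.
case: n => [|n].
  rewrite (_ : P 0 = set0) ?measure0 ?mule0; last first.
    by apply/seteqP; split=> // y; rewrite /P /= ltxx.
  by apply: integral_ge0 => y _; rewrite lee_fin.
have finF : (\int[nu]_y (F n.+1 y)%:E)%E \is a fin_num.
  by rewrite ge0_fin_numE//; apply: integral_ge0 => y _; rewrite lee_fin.
rewrite -(leeD2lE _ _ finF); apply: (le_trans (intF_step n)).
rewrite addeC leeD2r//; apply: ge0_le_integral => //.
- by move=> y _; rewrite lee_fin.
- by apply/measurable_EFinP.
- by apply/measurable_EFinP; exact: (mF n.+1).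
- by move=> y _; rewrite lee_fin.
Qed.

(** Hopf's maximal inequality, by Garsia's argument: F n <= F (n + 1), so the
    finite integrals of these two functions cancel in [intF_step]. *)
Lemma maximal_ineq (E : set Y) : measurable E ->
  E `<=` [set y | exists n, lam * wsum T w n (cst 1) y < wsum T w n g y] ->
  (lam%:E * nu E <= \int[nu]_y (g y)%:E)%E.
Proof.
move=> mE sE.
have sub : E `<=` \bigcup_n P n.
  move=> y /sE[n hn]; exists n => //; apply: lt_le_trans (F_ub n y).
  rewrite (_ : wsum _ _ _ _ _ = wsum T w n g y - lam * wsum T w n (cst 1) y).
    by rewrite subr_gt0.
  rewrite /wsum big_distrr/= -sumrB; apply: eq_bigr => k _; ring.
have nd : nondecreasing_seq P.
  by apply/nondecreasing_seqP => n; apply/subsetPset => y /lt_le_trans; exact.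
have mU : measurable (\bigcup_n P n) by exact: bigcup_measurable.
have cv := nondecreasing_cvg_mu mP mU nd.
apply: (@le_trans _ _ (lam%:E * nu (\bigcup_n P n))%E).
  by rewrite lee_pmul// le_measure// inE.
have cv2 : (lam%:E * nu (P n))%E @[n --> \oo] --> (lam%:E * nu (\bigcup_n P n))%E.
  by apply: cvgeZl => //; exact: cv.
rewrite -(cvg_lim _ cv2)//; apply: lime_le; first by apply/cvg_ex; eexists; exact: cv2.
by apply: nearW => n; exact: maximal_step.
Qed.

End Maximal.

(** * Densities of a nonsingular automorphism and conservativity *)

Lemma image_aut d (Y : measurableType d) (T : borel_aut Y) (A : set Y) :
  T @` A = aut_inv T @^-1` A.
Proof.
apply/seteqP; split=> [_ [x Ax <-]|y Ay] /=; first by rewrite aut_funK.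
by exists (aut_inv T y) => //; rewrite aut_invK.
Qed.

Lemma iter_autK d (Y : measurableType d) (T : borel_aut Y) k :
  cancel (iter k T) (iter k (aut_inv T)).
Proof.
elim: k => [|k ih] y //=.
by rewrite -iterS iterSr aut_funK ih.
Qed.

Lemma measurable_preimage d d' (X : measurableType d) (Y : measurableType d')
  (f : X -> Y) (A : set Y) : measurable_fun setT f -> measurable A ->
  measurable (f @^-1` A).
Proof. by move=> mf mA; rewrite -[X in measurable X]setTI; exact: mf. Qed.

Section Jacobian.
Context d (Y : measurableType d) (R : realType).
Variables (nu : probability Y R) (T : borel_aut Y).

Let iT : {mfun Y >-> Y} :=
  HB.pack (aut_inv T) (isMeasurableFun.Build _ _ _ _ _ (measurable_aut_inv T)).

Lemma nonsingular_jacobian : nonsingular nu T -> exists w, has_jacobian nu T w.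
Proof.
move=> nsT; pose nuT : probability Y R := distribution nu iT.
have dom : nuT `<< nu.
  apply/null_content_dominatesP => A mA A0.
  have -> : nuT A = nu (T @` A) by rewrite image_aut.
  exact/nsT.
have f0 := Radon_Nikodym_SigmaFinite.f_ge0 dom.
have ff := Radon_Nikodym_SigmaFinite.f_fin_num dom.
have mf : measurable_fun setT (Radon_Nikodym_SigmaFinite.f nuT nu).
  exact: measurable_int (Radon_Nikodym_SigmaFinite.f_integrable dom).
exists (fun y => fine (Radon_Nikodym_SigmaFinite.f nuT nu y)); split.
- exact: measurableT_comp.
- by move=> y; exact: fine_ge0.
move=> f mf' f'0.
under eq_integral do rewrite fineK// muleC.
rewrite (Radon_Nikodym_SigmaFinite.change_of_variables dom)//.
  rewrite /nuT /distribution (ge0_integral_pushforward (measurable_aut_inv T))//=.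
  - by apply: eq_integral => y _ /=; rewrite aut_invK.
  - exact: (measurableT_comp mf' (measurable_aut T)).
exact: (measurableT_comp mf' (measurable_aut T)).
Qed.

Variable w : Y -> R.
Hypothesis jw : has_jacobian nu T w.

Let mT := measurable_aut T.

(** The weights are the densities of the iterates: the right side is the measure
    of the image of E under the k-th iterate of T. *)
Lemma weight_integral k (E : set Y) : measurable E ->
  (\int[nu]_(y in E) (weight T w k y)%:E)%E = nu (iter k (aut_inv T) @^-1` E).
Proof.
move=> mE; set E' := _ @^-1` _.
have mE' : measurable E'.
  apply: measurable_preimage => //.
  exact: (measurable_iter (measurable_aut_inv T)).
rewrite -(setIT E') -integral_indic//.
rewrite -(integral_weight mT jw k (f := EFin \o \1_E'))//; last 2 first.
- by apply/measurable_EFinP; exact: measurable_indic.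
- by move=> y; rewrite lee_fin.
rewrite integral_mkcond; apply: eq_integral => y _ /=.
rewrite patchE indicE (_ : (iter k T y \in E') = (y \in E)).
  by case: ifP => _; rewrite ?mule1 ?mule0.
by apply/idP/idP; rewrite !inE /E' /= iter_autK.
Qed.

Lemma weight_integral_fin k : (\int[nu]_y (weight T w k y)%:E)%E = 1%E.
Proof. by rewrite weight_integral// preimage_setT probability_setT. Qed.

End Jacobian.

Section Divergence.
Context d (Y : measurableType d) (R : realType).
Variables (nu : probability Y R) (T : borel_aut Y) (w : Y -> R).
Hypotheses (nsT : nonsingular nu T) (cT : conservative nu T).
Hypothesis jw : has_jacobian nu T w.

Lemma nonsingular_iter k (A : set Y) : measurable A -> nu A = 0%E ->
  nu (iter k (aut_inv T) @^-1` A) = 0%E.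
Proof.
move=> mA A0; elim: k => // k ih.
rewrite (_ : _ @^-1` _ = T @` (iter k (aut_inv T) @^-1` A)).
  apply/nsT => //; apply: measurable_preimage => //.
  exact: measurable_iter (measurable_aut_inv T) k.
by rewrite image_aut; apply/seteqP; split=> y /=; rewrite -iterSr.
Qed.

(** A point of a wandering set returns to it only at time 0, against
    conservativity. *)
Lemma wandering_null (W : set Y) : measurable W ->
  (forall k y, W y -> W (iter k.+1 (aut_inv T) y) -> False) -> nu W = 0%E.
Proof.
move=> mW wW; apply/eqP; rewrite eq_le measure_ge0 andbT leNgt.
apply/negP => W0; have [N [mN N0 sN]] := cT mW W0.
have : ~ (W `<=` N).
  move=> WN; move: W0; rewrite lt_neqAle => /andP[/eqP + _]; apply.
  by apply/esym/eqP; rewrite eq_le measure_ge0 andbT -N0 le_measure// inE.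
apply => y Wy; apply: sN => /= /(_ Wy); apply.
apply: (@sub_finite_set _ _ [set 0]); last exact: finite_set1.
move=> [[//|k]|k] /= Wn; exfalso; last exact: (wW k y).
by apply: (wW k (iter k.+1 T y)) => //; rewrite iter_autK.
Qed.

(** If the weights along the orbits of points of W sum to at most K, then so do
    the measures of the images of W under T^n, n >= 0, and by Borel-Cantelli
    almost every point visits W finitely often in the past.  Its earliest visit
    lies in a wandering set, which is null, and so W is null. *)
Lemma weight_diverge :
  {ae nu, forall y, forall K : R, exists n, K < wsum T w n (cst 1) y}.
Proof.
pose W K := [set y | forall n, wsum T w n (cst 1) y <= K%:R].
have mW K : measurable (W K).
  rewrite (_ : W K = \bigcap_n (wsum T w n (cst 1) @^-1` `]-oo, K%:R]%classic)).
    apply: bigcapT_measurable => n; apply: measurable_preimage => //.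
    apply: (measurable_wsum (measurable_aut T) jw) => //.
  apply/seteqP; split=> y /=.
    by move=> Wy n _; rewrite /= in_itv/=; exact: Wy.
  by move=> h n; have := h n Logic.I; rewrite /= in_itv/=.
suff W0 K : nu (W K) = 0%E.
  apply: (@negligibleS _ _ _ _ (\bigcup_K W K)).
    move=> y /= /existsNP[K /forallNP h].
    exists (Num.truncn `|K|).+1 => //= n.
    have /negP := h n; rewrite -leNgt => /le_trans; apply.
    by apply: le_trans (ler_norm K) _; apply/ltW; rewrite truncnS_gt.
  apply: negligible_bigcup => K; exists (W K).
  by split; [exact: mW|exact: W0|].
pose F k := iter k (aut_inv T) @^-1` W K.
have mF k : measurable (F k).
  by apply: measurable_preimage => //; exact: (measurable_iter (measurable_aut_inv T)).
have mwt k := measurable_weight (measurable_aut T) jw k.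
have w0 : forall y, 0 <= w y by case: jw.
have Fsum : (\sum_(n <oo) nu (F n) < +oo)%E.
  apply: (@le_lt_trans _ _ K%:R%:E); last exact: ltry.
  apply: lime_le; first by apply: is_cvg_nneseries => *; exact: measure_ge0.
  apply: nearW => n; rewrite big_mkord.
  under eq_bigr do rewrite -(weight_integral jw)//.
  rewrite -ge0_integral_sum//; last 2 first.
  - by move=> k; apply: measurable_funTS; apply/measurable_EFinP; exact: mwt.
  - by move=> k y _; rewrite lee_fin; exact: weight_ge0.
  apply: (@le_trans _ _ (\int[nu]_(y in W K) (cst K%:R%:E) y)%E).
    apply: ge0_le_integral => //.
    - by move=> y _; apply: sume_ge0 => k _; rewrite lee_fin; exact: weight_ge0.
    - apply: measurable_funTS; apply: emeasurable_sum => k.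
      by apply/measurable_EFinP; exact: mwt.
    - move=> y /(_ n); rewrite /wsum => h; rewrite sumEFin /cst/= lee_fin.
      by under eq_bigr do rewrite -[weight _ _ _ _]mulr1.
  rewrite integral_cst//= -[leRHS]mule1 lee_pmul//.
  exact: probability_le1.
have BC := lim_sup_set_cvg0 mF Fsum.
pose W0 := W K `\` \bigcup_n F n.+1.
have mW0 : measurable W0 by apply: measurableD => //; exact: bigcup_measurable.
have W00 : nu W0 = 0%E.
  apply: wandering_null => // k y [Wy nWy] [Wky _]; apply: nWy.
  by exists k.
apply/(negligibleP _ (mW K)).
apply: (@negligibleS _ _ _ _
    (lim_sup_set F `|` \bigcup_n (iter n (aut_inv T) @^-1` W0))).
  move=> y Wy; apply: contrapT => /not_orP[nsup nbig].
  have [m mF'] : exists m, forall k, (m <= k)%N -> ~ F k y.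
    move/existsNP : nsup => [m /not_implyP[_ h]]; exists m => k mk Fky.
    by apply: h; exists k.
  have ex : exists n, `[< F n y >] by exists 0%N; apply/asboolP.
  have ub n : `[< F n y >] -> (n <= m)%N.
    move=> /asboolP Fn; rewrite leqNgt; apply/negP => mn.
    exact: (mF' n (ltnW mn)).
  have [n /asboolP Fn nmax] := ex_maxnP ex ub.
  apply: nbig; exists n => //; split => // -[j _].
  rewrite /F /= -iterS -iterD => Fj.
  by have := nmax (j.+1 + n)%N; rewrite addSn ltnNge leq_addl /= => /(_ (asboolT Fj)).
apply: negligibleU; first by exists (lim_sup_set F); split => //; apply: bigcap_measurable => // j _; exact: bigcup_measurable.
apply: negligible_bigcup => n; exists (iter n (aut_inv T) @^-1` W0); split=> //.
- apply: measurable_preimage => //; exact: (measurable_iter (measurable_aut_inv T)).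
- exact: nonsingular_iter.
Qed.

End Divergence.

(** * The Hopf argument *)

Section Compare.
Context d (Y : measurableType d) (R : realType) (nu : probability Y R).

Lemma integral_comp_le (Phi : Y -> Y) (C : R) (f : Y -> \bar R) :
  measurable_fun setT Phi -> 0 <= C ->
  (forall E, measurable E -> (nu (Phi @^-1` E) <= C%:E * nu E)%E) ->
  measurable_fun setT f -> (forall y, (0 <= f y)%E) ->
  (\int[nu]_y f (Phi y) <= C%:E * \int[nu]_y f y)%E.
Proof.
move=> mPhi C0 hC mf f0.
pose PhiM : {mfun Y >-> Y} :=
  HB.pack Phi (isMeasurableFun.Build _ _ _ _ _ mPhi).
have -> : (\int[nu]_y f (Phi y) = \int[distribution nu PhiM]_y f y)%E.
  by rewrite /distribution (ge0_integral_pushforward mPhi).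
rewrite -[leRHS](ge0_integral_mscale nu measurableT (NngNum C0))//.
exact: ge0_le_measure_integral.
Qed.

Lemma ae_le_integral_set (f g : Y -> R) :
  measurable_fun setT f -> measurable_fun setT g ->
  (forall y, 0 <= g y) -> (\int[nu]_y (g y)%:E < +oo)%E ->
  (forall E, measurable E ->
     (\int[nu]_(y in E) (f y)%:E <= \int[nu]_(y in E) (g y)%:E)%E) ->
  {ae nu, forall y, f y <= g y}.
Proof.
move=> mf mg g0 ig fg; pose E := [set y | g y < f y].
have mE : measurable E.
  rewrite (_ : E = (f \- g) @^-1` `]0, +oo[%classic).
    by apply: measurable_preimage => //; exact: measurable_funB.
  by apply/seteqP; split=> y; rewrite /E /= in_itv/= andbT subr_gt0.
suff E0 : nu E = 0%E.
  by exists E; split => // y /= /negP; rewrite -ltNge.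
have ifin : (\int[nu]_(y in E) (g y)%:E)%E \is a fin_num.
  rewrite ge0_fin_numE; last by apply: integral_ge0 => y _; rewrite lee_fin.
  apply: le_lt_trans ig; apply: ge0_subset_integral => //.
  - exact/measurable_EFinP.
  - by move=> y _; rewrite lee_fin.
pose h y := (f y - g y)%:E.
have mh : measurable_fun E h.
  by apply: measurable_funTS; apply/measurable_EFinP; exact: measurable_funB.
have h0 y : E y -> (0 <= h y)%E by move=> Ey; rewrite lee_fin subr_ge0 ltW.
have ih : (\int[nu]_(y in E) h y = 0)%E.
  apply/eqP; rewrite eq_le; apply/andP; split; last exact: integral_ge0.
  rewrite -(leeD2lE _ _ ifin) adde0 -ge0_integralD//.
  - apply: le_trans (fg E mE); rewrite le_eqVlt; apply/orP; left; apply/eqP.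
    by apply: eq_integral => y _; rewrite /h -EFinD addrC subrK.
  - by move=> y _; rewrite lee_fin.
  - by apply: measurable_funTS; exact/measurable_EFinP.
have : ae_eq nu E h (cst 0%E).
  apply/(ae_eq_integral_abs nu mE mh).
  by under eq_integral => y /[!inE] Ey do rewrite gee0_abs ?h0//.
move=> [N [mN N0 sN]]; apply/(negligibleP _ mE); exists N; split=> // y Ey.
by apply: sN => /= /(_ Ey)[] /eqP; rewrite subr_eq0 gt_eqF.
Qed.

End Compare.

(** Here a and b stand for the total weights of the orbits of y and Phi y up to
    time n, and K for the weight of y before the two orbits become
    indistinguishable.  The value of lam makes lam * a + c * (lam * (c * a))
    equal to half of a. *)
Lemma weighted_sums_incompatible (R : realType) (lam c K a b : R) :
  lam = (2 * (1 + c ^+ 2))^-1 -> 1 <= c -> 2 * K < a -> b <= c * a ->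
  (1 - lam) * a <= K + c * (lam * b) -> False.
Proof.
move=> -> c1 Ka bc h.
set l := (_ * _)^-1 in h.
have lE : l * (2 * (1 + c ^+ 2)) = 1.
  by rewrite mulVf// gt_eqF// mulr_gt0// ltr_pwDl// sqr_ge0.
have l0 : 0 <= l by rewrite invr_ge0 mulr_ge0// addr_ge0// sqr_ge0.
have : c * (l * b) <= c * (l * (c * a)).
  by rewrite ler_wpM2l ?ler_wpM2l// (le_trans ler01).
have e : l * a + c * (l * (c * a)) = a / 2.
  clearbody l; transitivity (l * (2 * (1 + c ^+ 2)) * a / 2); first by field.
  by rewrite lE mul1r.
lra.
Qed.

Section HopfExchange.
Context d (Y : measurableType d) (R : realType).
Variables (nu : probability Y R) (T : borel_aut Y) (w : Y -> R).
Hypothesis jw : has_jacobian nu T w.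
Hypothesis divw : {ae nu, forall y, forall K : R, exists n, K < wsum T w n (cst 1) y}.
Variables (Phi : Y -> Y) (C : R).
Hypotheses (mPhi : measurable_fun setT Phi) (PhiK : involutive Phi).
(* The set on the left is the image of Phi E under the k-th iterate of T, and the
   one on the right is the image of E. *)
Hypothesis PhiC : forall k E, measurable E ->
  (nu ((Phi \o iter k (aut_inv T)) @^-1` E) <=
   C%:E * nu (iter k (aut_inv T) @^-1` E))%E.

Let mT := measurable_aut T.
Let w0 y : 0 <= w y. Proof. by case: jw => _ + _; exact. Qed.
Let wt0 k y : 0 <= weight T w k y. Proof. exact: weight_ge0. Qed.
Let mwt k : measurable_fun setT (weight T w k).
Proof. exact: (measurable_weight mT jw). Qed.

Let C1 : 1 <= C.
Proof.
have := PhiC 0 measurableT.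
by rewrite !preimage_setT probability_setT mule1 lee_fin.
Qed.

Let C0 : 0 <= C. Proof. exact: le_trans C1. Qed.

Let Phi_le E : measurable E -> (nu (Phi @^-1` E) <= C%:E * nu E)%E.
Proof. by move=> mE; exact: (PhiC 0 mE). Qed.

(** Integrating over a set E and using that [Phi] is an involution, both the
    substitution y |-> Phi y and the comparison of the images of E and Phi E
    under the k-th iterate cost a factor C; whence C ^ 2. *)
Lemma weight_exchange k :
  {ae nu, forall y, weight T w k (Phi y) <= C ^+ 2 * weight T w k y}.
Proof.
apply: ae_le_integral_set.
- exact: (measurableT_comp (mwt k) mPhi).
- exact: measurable_funM.
- by move=> y; rewrite mulr_ge0// sqr_ge0.
- under eq_integral do rewrite EFinM.
  rewrite ge0_integralZl//; last 3 first.
  + by apply/measurable_EFinP.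
  + by move=> y _; rewrite lee_fin.
  + by rewrite lee_fin sqr_ge0.
  by rewrite weight_integral_fin// mule1 ltry.
move=> E mE; have mPE := measurable_preimage mPhi mE.
have mEFw : measurable_fun setT (EFin \o weight T w k) by apply/measurable_EFinP.
have mp : measurable_fun setT ((EFin \o weight T w k) \_ (Phi @^-1` E)).
  by apply/(measurable_restrictT _ mPE); exact: measurable_funTS.
apply: (@le_trans _ _ (\int[nu]_y ((EFin \o weight T w k) \_ (Phi @^-1` E)) (Phi y))%E).
  rewrite integral_mkcond le_eqVlt; apply/orP; left; apply/eqP.
  apply: eq_integral => y _; rewrite !patchE /=.
  suff -> : (Phi y \in Phi @^-1` E) = (y \in E) by [].
  by apply/idP/idP; rewrite !inE /= PhiK.
apply: (le_trans (integral_comp_le mPhi C0 Phi_le mp _)).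
  by move=> y; rewrite patchE; case: ifP => // _; rewrite lee_fin.
rewrite -integral_mkcond weight_integral//.
under [leRHS]eq_integral do rewrite EFinM.
rewrite [leRHS]ge0_integralZl//; last 3 first.
- exact: measurable_funTS.
- by move=> y _; rewrite lee_fin.
- by rewrite lee_fin sqr_ge0.
rewrite weight_integral// expr2 EFinM -muleA lee_pmul2l ?lte_fin ?(lt_le_trans ltr01)//.
exact: PhiC.
Qed.

Let ae_Phi (P : Y -> Prop) : {ae nu, forall y, P y} -> {ae nu, forall y, P (Phi y)}.
Proof.
move=> [N [mN N0 sN]]; exists (Phi @^-1` N); split.
- exact: measurable_preimage.
- apply/eqP; rewrite eq_le measure_ge0 andbT; apply: le_trans (Phi_le mN) _.
  by rewrite N0 mule0.
- by move=> y /= nP; apply: sN.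
Qed.

(* Such a set D does not distinguish the orbits of y and Phi y after time N. *)
Hypothesis dense : forall (A : set Y) (e : R), measurable A -> 0 < e ->
  exists D : set Y, [/\ measurable D, (nu (A `\` D) <= e%:E)%E,
    (nu (D `\` A) <= e%:E)%E &
    exists N, forall n y, (N <= n)%N ->
      D (iter n T (Phi y)) <-> D (iter n T y)].

(** The points of A that [Phi] sends outside A form a null set.  Otherwise some
    such y avoids, together with Phi y, the exceptional set E of the maximal
    inequality for the symmetric difference G of A and an approximation D.  Up
    to the fraction lam, the orbit of y then lies in D and the orbit of Phi y
    outside D, although D separates them during a finite time only. *)
Lemma hopf_exchange (A : set Y) : measurable A -> T @^-1` A = A ->
  nu (A `&` Phi @^-1` (~` A)) = 0%E.
Proof.
move=> mA TA; set B := _ `&` _.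
have mB : measurable B.
  by apply: measurableI => //; apply: measurable_preimage => //; exact: measurableC.
have TkA k y : A (iter k T y) <-> A y.
  elim: k => // k <-; rewrite /= -[X in A X <-> _]/(T _).
  by rewrite -[in X in _ <-> X]TA.
apply/eqP; rewrite eq_le measure_ge0 andbT leNgt; apply/negP => B0.
have [beta betaE beta0] : exists2 b, nu B = b%:E & 0 < b.
  exists (fine (nu B)); first by rewrite fineK ?fin_num_measure.
  by rewrite fine_gt0// B0 ltey_eq fin_num_measure.
pose c := C ^+ 2.
have c1 : 1 <= c by rewrite exprn_ege1.
pose lam := (2 * (1 + c ^+ 2))^-1.
have lam0 : 0 < lam by rewrite invr_gt0 mulr_gt0// ltr_pwDl// sqr_ge0.
(* With this error the exceptional sets of y and of Phi y together have measure
   at most beta / 2. *)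
pose e := beta * lam / (4 * (1 + C)).
have e0 : 0 < e by rewrite divr_gt0 ?mulr_gt0// ltr_pwDl.
have [D [mD AD DA [N DPhi]]] := dense mA e0.
pose G := (A `\` D) `|` (D `\` A).
have mG : measurable G by apply: measurableU; exact: measurableD.
have nuG : (nu G <= (2 * e)%:E)%E.
  rewrite (_ : 2 * e = e + e); last by ring.
  rewrite EFinD; apply: le_trans (leeD AD DA).
  by apply: measureU2; exact: measurableD.
have mw1 n : measurable_fun setT (wsum T w n (cst 1)).
  exact: (measurable_wsum mT jw).
have mwG n : measurable_fun setT (wsum T w n \1_G).
  exact: (measurable_wsum mT jw).
pose E := [set y | exists n, lam * wsum T w n (cst 1) y < wsum T w n \1_G y].
have mE : measurable E.
  rewrite (_ : E = \bigcup_n ((wsum T w n \1_G \- (lam \*o wsum T w n (cst 1)))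
      @^-1` `]0, +oo[%classic)).
    apply: bigcupT_measurable => n; apply: measurable_preimage => //.
    by apply: measurable_funB => //; exact: measurable_funM.
  apply/seteqP; split=> y /=.
    by move=> [n h]; exists n => //; rewrite /= in_itv/= andbT subr_gt0.
  by move=> [n _]; rewrite /= in_itv/= andbT subr_gt0 => h; exists n.
have nuE : (nu E <= (2 * e / lam)%:E)%E.
  have h : (lam%:E * nu E <= nu G)%E.
    rewrite -(setIT G) -integral_indic//.
    apply: (maximal_ineq mT jw _ _ (ltW lam0)) => //.
    by rewrite integral_indic// setIT (le_lt_trans nuG)// ltry.
  by rewrite EFinM lee_pdivlMr// muleC (le_trans h).
have nuPE : (nu (Phi @^-1` E) <= (C * (2 * e / lam))%:E)%E.
  apply: (le_trans (Phi_le mE)).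
  by rewrite EFinM lee_pmul2l// ?lte_fin ?(lt_le_trans ltr01).
have aew : {ae nu, forall y, forall k, weight T w k (Phi y) <= c * weight T w k y}.
  by apply: ae_foralln => k; exact: weight_exchange.
have [M [mM M0 sM]] : nu.-negligible (~` [set y |
    [/\ forall K : R, exists n, K < wsum T w n (cst 1) y,
     forall k, weight T w k (Phi y) <= c * weight T w k y &
     forall k, weight T w k y <= c * weight T w k (Phi y)]]).
  have aew' := ae_Phi aew.
  have : {ae nu, forall y, [/\ forall K : R, exists n, K < wsum T w n (cst 1) y,
     forall k, weight T w k (Phi y) <= c * weight T w k y &
     forall k, weight T w k (Phi (Phi y)) <= c * weight T w k (Phi y)]}.
    by apply: filterS3 divw aew aew' => y.
  by apply: filterS => y; rewrite PhiK.
have [y [By yE PyE yM]] : exists y, [/\ B y, ~ E y, ~ E (Phi y) & ~ M y].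
  apply: contrapT => /forallNP ny.
  have sub : B `<=` E `|` Phi @^-1` E `|` M.
    move=> y By; apply: contrapT => /not_orP[/not_orP[? ?] ?].
    by apply: (ny y).
  have : (nu B <= (2 * e / lam)%:E + (C * (2 * e / lam))%:E + 0)%E.
    have mPE := measurable_preimage mPhi mE.
    apply: (@le_trans _ _ (nu (E `|` Phi @^-1` E `|` M))).
      by rewrite le_measure// inE//; do 2?[apply: measurableU => //].
    have mEE := measurableU _ _ mE mPE.
    apply: (le_trans (measureU2 _ mEE mM)); rewrite leeD//; last by rewrite le_eqVlt; apply/orP; left; apply/eqP; exact: M0.
    by apply: (le_trans (measureU2 _ mE mPE)); rewrite leeD.
  rewrite betaE adde0 -EFinD lee_fin.
  have -> : 2 * e / lam + C * (2 * e / lam) = beta / 2.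
    rewrite /e; field.
    by rewrite (gt_eqF lam0)/= gt_eqF// ltr_pwDl.
  by rewrite leNgt ltr_pdivrMr// ltr_pMr// ltr1n.
have {sM yM} [ydiv wPy wy] := contrapT (fun h => yM (sM y h)).
have [Ay /= nAPy] := By.
pose K := wsum T w N (cst 1) y.
have [n] := ydiv (2 * K).
set a := wsum T w n (cst 1) y => Ka.
pose b := wsum T w n (cst 1) (Phi y).
apply: (@weighted_sums_incompatible R lam c K a b) => //.
  rewrite /b /a /wsum big_distrr/=; apply: ler_sum => k _.
  by rewrite !mulr1.
have s1 : (1 - lam) * a <= wsum T w n \1_D y.
  have hG : wsum T w n \1_G y <= lam * a.
    by rewrite leNgt; apply/negP => hn; apply: yE; exists n.
  suff : a <= wsum T w n \1_D y + wsum T w n \1_G y by lra.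
  rewrite /a /wsum -big_split/=; apply: ler_sum => k _.
  rewrite -mulrDr ler_wpM2l// !indicE.
  have Ak : A (iter k T y) by apply/TkA.
  have [|nD] := boolP (_ \in D); first by rewrite lerDl.
  rewrite add0r (_ : _ \in G)// inE; left; split => //.
  by move=> Dk; move/negP : nD; apply; rewrite inE.
have s2 : wsum T w n \1_D (Phi y) <= lam * b.
  apply: (@le_trans _ _ (wsum T w n \1_G (Phi y))); last first.
    by rewrite leNgt; apply/negP => hn; apply: PyE; exists n.
  apply: ler_sum => k _; rewrite ler_wpM2l// !indicE.
  have [|//] := boolP (_ \in D); rewrite inE => Dk.
  rewrite (_ : _ \in G)// inE; right; split => //.
  by move/TkA.
have s3 : wsum T w n \1_D y <= K + c * wsum T w n \1_D (Phi y).
  apply: (@le_trans _ _ (\sum_(k < n) (weight T w k y * (k < N)%:R) +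
      c * wsum T w n \1_D (Phi y))).
    rewrite /wsum big_distrr/= -big_split/=; apply: ler_sum => k _.
    have [kN|Nk] := ltnP k N.
      rewrite mulr1 ler_wpDr//; first by rewrite !mulr_ge0// (le_trans ler01).
      by rewrite ler_piMr// indicE lern1 leq_b1.
    rewrite mulr0 add0r mulrA ler_pM//.
    rewrite !indicE ler_nat.
    rewrite (_ : (iter k T y \in D) = (iter k T (Phi y) \in D))//.
    by apply/idP/idP; rewrite !inE => /(DPhi _ _ Nk).
  rewrite lerD2r /K /wsum.
  have [nN|Nn] := leqP n N.
    rewrite (big_ord_widen N (fun k => weight T w k y * (k < N)%:R))// big_mkcond/=.
    apply: ler_sum => k _; rewrite ltn_ord; case: ifP => // _.
    by rewrite mulr1.
  rewrite [leRHS](big_ord_widen n (fun k => weight T w k y * cst 1 (iter k T y)) (ltnW Nn)) [leRHS]big_mkcond/=.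
  by apply: ler_sum => k _; case: ifP => _; rewrite ?mulr0.
apply: (le_trans s1); apply: (le_trans s3); rewrite lerD2l ler_wpM2l//.
exact: le_trans c1.
Qed.

End HopfExchange.

(** * Products with a measure-preserving automorphism *)

Section Product.
Context d1 d2 (X : measurableType d1) (Z : measurableType d2) (R : realType).
Variables (mu : probability X R) (m : probability Z R).
Variables (T : borel_aut X) (Q : borel_aut Z) (w : X -> R).
Hypotheses (jw : has_jacobian mu T w) (pQ : measure_preserving m Q).

Lemma iter_prod_aut k (p : X * Z) :
  iter k (prod_aut T Q) p = (iter k T p.1, iter k Q p.2).
Proof. by elim: k => [|k ih]; [case: p|rewrite /= ih]. Qed.

Lemma iter_prod_aut_inv k (p : X * Z) :
  iter k (aut_inv (prod_aut T Q)) p =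
  (iter k (aut_inv T) p.1, iter k (aut_inv Q) p.2).
Proof. by elim: k => [|k ih]; [case: p|rewrite /= ih]. Qed.

Lemma prod_jacobian : has_jacobian (mu \x m)%E (prod_aut T Q) (w \o fst).
Proof.
have [mw w0 jf] := jw; split.
- exact: (measurableT_comp mw measurable_fst).
- by move=> p; exact: w0.
move=> f mf f0; have mprod := measurable_aut (prod_aut T Q).
rewrite fubini_tonelli2; last 2 first.
- apply: emeasurable_funM.
    by apply/measurable_EFinP; exact: (measurableT_comp mw measurable_fst).
  exact: (measurableT_comp mf mprod).
- by move=> p; rewrite mule_ge0// lee_fin; exact: w0.
transitivity (\int[m]_z \int[mu]_x f (x, Q z))%E.
  apply: eq_integral => z _; rewrite /fubini_G/=.
  rewrite -(jf (fun x => f (x, Q z)))//.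
  exact: (measurableT_comp mf (measurable_pair2 (Q z))).
rewrite -(fubini_tonelli (fun p : X * Z => f (p.1, Q p.2)))//; last first.
  apply: (measurableT_comp mf); apply: measurable_fun_pair => //.
  exact: (measurableT_comp (measurable_aut Q)).
rewrite fubini_tonelli1//; apply: eq_integral => x _; rewrite /fubini_F/=.
have mfx : measurable_fun setT (fun z => f (x, z)).
  exact: (measurableT_comp mf (measurable_pair1 x)).
rewrite -(ge0_integral_pushforward (measurable_aut Q) m measurableT mfx)//.
apply: eq_measure_integral; first exact: (measurable_aut Q).
by move=> mQ A mA _; exact: pQ.
Qed.

Lemma weight_prod k (p : X * Z) :
  weight (prod_aut T Q) (w \o fst) k p = weight T w k p.1.
Proof. by apply: eq_bigr => j _; rewrite iter_prod_aut. Qed.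

Lemma prod_diverge :
  {ae mu, forall x, forall K : R, exists n, K < wsum T w n (cst 1) x} ->
  {ae (mu \x m)%E, forall p, forall K : R,
     exists n, K < wsum (prod_aut T Q) (w \o fst) n (cst 1) p}.
Proof.
move=> [N [mN N0 sN]]; exists (N `*` setT); split.
- exact: measurableX.
- rewrite product_measure1E//; transitivity (0 * m setT)%E; last by rewrite mul0e.
  by congr (_ * _)%E.
move=> [x z] /= h; split=> //; apply: sN => h'; apply: h => K.
have [n hn] := h' K; exists n; move: hn; rewrite /wsum.
by under [X in _ -> _ < X]eq_bigr do rewrite weight_prod.
Qed.

End Product.

(** * Approximation by an algebra of sets *)

Section Approximation.
Context d (Y : measurableType d) (R : realType).
Variables (rho : {measure set Y -> \bar R}) (L : set (set Y)).
Hypotheses (rho_fin : (rho setT < +oo)%E).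
Hypotheses (mL : L `<=` measurable) (L0 : L set0).
Hypotheses (LC : forall A, L A -> L (~` A)).
Hypotheses (LU : forall A B, L A -> L B -> L (A `|` B)).

Let approx : set (set Y) := [set A | measurable A /\ forall e : R, 0 < e ->
  exists D, [/\ L D, (rho (A `\` D) <= e%:E)%E & (rho (D `\` A) <= e%:E)%E]].

Let le_rho A B : measurable A -> measurable B -> A `<=` B ->
  (rho A <= rho B)%E.
Proof. by move=> mA mB AB; rewrite le_measure// inE. Qed.

Let approx0 : approx set0.
Proof.
split=> // e e0; exists set0.
by split=> //; rewrite setD0 measure0 lee_fin ltW.
Qed.

Let approxC A : approx A -> approx (setT `\` A).
Proof.
move=> [mA hA]; split; first exact: measurableD.
move=> e /hA[D [LD AD DA]]; exists (~` D); split; first exact: LC.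
- by rewrite (_ : _ `\` ~` D = D `\` A)// setTD !setDE setCK setIC.
- by rewrite (_ : _ `\` (_ `\` A) = A `\` D)// setTD !setDE setCK setIC.
Qed.

Let approxU A B : approx A -> approx B -> approx (A `|` B).
Proof.
move=> [mA hA] [mB hB]; split; first exact: measurableU.
move=> e e0; have e2 : 0 < e / 2 by rewrite divr_gt0.
have [D [LD AD DA]] := hA _ e2; have [E [LE BE EB]] := hB _ e2.
have [mD mE] := (mL LD, mL LE).
exists (D `|` E); split; first exact: LU.
- rewrite (splitr e) EFinD; apply: le_trans (leeD AD BE).
  apply: le_trans (measureU2 _ _ _); [|exact: measurableD..].
  apply: le_rho; first by apply: measurableD; exact: measurableU.
    by apply: measurableU; exact: measurableD.
  by move=> y [[Ay|By] /not_orP[nD nE]]; [left|right].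
- rewrite (splitr e) EFinD; apply: le_trans (leeD DA EB).
  apply: le_trans (measureU2 _ _ _); [|exact: measurableD..].
  apply: le_rho; first by apply: measurableD; exact: measurableU.
    by apply: measurableU; exact: measurableD.
  by move=> y [[Dy|Ey] /not_orP[nA nB]]; [left|right].
Qed.

(* The union of the first N sets misses a set W N whose measure tends to 0. *)
Let approx_bigcup (F : (set Y)^nat) : (forall n, approx (F n)) ->
  approx (\bigcup_n F n).
Proof.
move=> aF; have mF n : measurable (F n) by have [] := aF n.
have mU : measurable (\bigcup_n F n) by exact: bigcup_measurable.
split=> // e e0; have e2 : 0 < e / 2 by rewrite divr_gt0.
pose V N := \big[setU/set0]_(i < N) F i.
have aV N : approx (V N).
  by elim: N => [|N ih]; rewrite /V ?big_ord0 ?big_ord_recr//; exact: approxU.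
have mV N : measurable (V N) by have [] := aV N.
pose W N := \bigcup_n F n `\` V N.
have mW N : measurable (W N) by exact: measurableD.
have capW : \bigcap_N W N = set0.
  apply/seteqP; split=> // y capy.
  have [[n _ Fny] _] := capy 0%N Logic.I.
  have [_] := capy n.+1 Logic.I; apply.
  by rewrite /V -bigcup_mkord; exists n => /=.
have niW : nonincreasing_seq W.
  apply/nonincreasing_seqP => n; apply/subsetPset; apply: setDS.
  by rewrite /V big_ord_recr/=; exact: subsetUl.
have cvW : rho (W n) @[n --> \oo] --> 0%E.
  rewrite -(measure0 rho) -capW; apply: nonincreasing_cvg_mu => //.
  - by apply: le_lt_trans rho_fin; exact: le_rho.
  - by rewrite capW.
have [N WN] : exists N, (rho (W N) <= (e / 2)%:E)%E.
  apply: contrapT => /forallNP h.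
  have : ((e / 2)%:E <= limn (rho \o W))%E.
    apply: lime_ge; first by apply/cvg_ex; exists 0%E.
    by apply: nearW => n; rewrite leNgt; apply/negP => /ltW; exact: h.
  by rewrite (cvg_lim _ cvW)// lee_fin leNgt e2.
have [D [LD VD DV]] := (aV N).2 _ e2.
have mD := mL LD.
exists D; split => //.
- rewrite (splitr e) EFinD; apply: le_trans (leeD WN VD).
  apply: le_trans (measureU2 _ _ _); [|exact: mW|exact: measurableD].
  apply: le_rho; first exact: measurableD.
    by apply: measurableU => //; exact: measurableD.
  move=> y [Uy nD]; have [Vy|nV] := pselect (V N y); [right|left] => //.
- apply: (@le_trans _ _ (e / 2)%:E); last by rewrite lee_fin ler_pdivrMr// ler_peMr ?ler1n// ltW.
  apply: le_trans DV; apply: le_rho; [exact: measurableD..|].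
  apply: setDS => y; rewrite /V -bigcup_mkord => -[i _ Fi]; by exists i.
Qed.

Lemma algebra_approx (A : set Y) (e : R) : <<s L >> A -> 0 < e ->
  exists D, [/\ L D, (rho (A `\` D) <= e%:E)%E & (rho (D `\` A) <= e%:E)%E].
Proof.
move=> sA e0; suff [_] : approx A by apply.
move: A sA; apply: smallest_sub.
  by split; [exact: approx0|exact: approxC|exact: approx_bigcup].
move=> D LD; split; first exact: mL.
by move=> e' e'0; exists D; rewrite setDv measure0 lee_fin ltW.
Qed.

End Approximation.

Lemma fibre_sum d (Y : measurableType d) (R : realType)
    (rho : {measure set Y -> \bar R}) (I : finType) (g : Y -> I) (E : set Y) :
  measurable E -> (forall i, measurable (g @^-1` [set i])) ->
  rho E = (\sum_(i : I) rho (E `&` g @^-1` [set i]))%E.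
Proof.
move=> mE mg.
rewrite (fsbig_seq _ _ (index_enum_uniq I)) -measure_fin_bigcup//; last 2 first.
- apply/trivIsetP => i j _ _ ij; apply/seteqP; split=> // y /= [[_ yi] [_ yj]].
  by move/eqP : ij; apply; rewrite -yi -yj.
- by move=> i _; exact: measurableI.
congr (rho _); apply/seteqP; split=> y.
  by move=> Ey; exists (g y) => //=; rewrite mem_index_enum.
by move=> [i _ []].
Qed.

(** * Sets that depend on finitely many coordinates *)

Section Balls.
Variables (S : finType) (M : rel S) (S0 : (0 < #|S|)%N) (prM : primitive M).
Local Notation X := (markov_shift S0 prM).

Lemma markov_shift_eq (x y : X) : sval x =1 sval y -> x = y.
Proof.
move=> xy; apply: eq_sig_hprop; last exact/funext.
by move=> ? ? ?; exact: bool_irrelevance.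
Qed.

Lemma shiftspace_step (x : X) l : M (sval x l) (sval x (l + 1)).
Proof. by have := svalP x; rewrite inE; exact. Qed.

Lemma admissible_sval (x : X) i j : admissible M i j (sval x).
Proof. by move=> l _ _; exact: shiftspace_step. Qed.

(** The balls of the usual ultrametric of the shift space. *)
Definition ball_of (n : nat) (x : X) : set X :=
  cylinder (- n%:Z) n%:Z (sval x).

Lemma ball_sym n x y : ball_of n x y -> ball_of n y x.
Proof. by move=> xy l l1 l2; rewrite xy. Qed.

Lemma ball_le m n x y : (m <= n)%N -> ball_of n x y -> ball_of m x y.
Proof. by move=> mn xy l l1 l2; apply: xy; lia. Qed.

Lemma measurable_ball n x : measurable (ball_of n x).
Proof. by apply: measurable_cylinder; [lia|exact: admissible_sval]. Qed.

Definition word (n : nat) (x : X) : {ffun 'I_(n + n).+1 -> S} :=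
  [ffun k : 'I_(n + n).+1 => sval x (k%:Z - n%:Z)].

Lemma wordP n x y : word n y = word n x <-> ball_of n x y.
Proof.
split=> [/ffunP e l l1 l2|e].
  have lt : (absz (l + n%:Z)%R < (n + n).+1)%N by lia.
  have := e (Ordinal lt); rewrite !ffunE /=.
  by rewrite (_ : (absz (l + n%:Z))%:Z - n%:Z = l); last lia.
by apply/ffunP => k; rewrite !ffunE; apply: e; have := ltn_ord k; lia.
Qed.

Lemma word_preimage n x : word n @^-1` [set word n x] = ball_of n x.
Proof. by apply/seteqP; split=> y /= /wordP. Qed.

Lemma word_fibre n w :
  word n @^-1` [set w] = set0 \/ exists x, word n @^-1` [set w] = ball_of n x.
Proof.
have [[x xw]|nx] := pselect (exists x, word n x = w).
  by right; exists x; rewrite -xw word_preimage.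
by left; apply/seteqP; split=> // y yw; apply: nx; exists y.
Qed.

Lemma measurable_word n w : measurable (word n @^-1` [set w]).
Proof.
by have [->//|[x ->]] := word_fibre w; exact: measurable_ball.
Qed.

(** A set that depends on the coordinates in a window is a union of cylinders
    over the finitely many words of that window. *)
Lemma measurable_ball_invariant n (D : set X) :
  (forall x y, ball_of n x y -> D x -> D y) -> measurable D.
Proof.
move=> lD.
have -> : D = \bigcup_(w in word n @` D) (word n @^-1` [set w]).
  apply/seteqP; split=> x; first by move=> Dx; exists (word n x) => //; exists x.
  move=> [_ [y Dy <-]] /= /wordP yx; exact: lD Dy.
apply: fin_bigcup_measurable; last by move=> w _; exact: measurable_word.
exact: finite_finset.
Qed.

Section Local.
Context d (Z : measurableType d).

Lemma measurable_window i j a : i <= j -> admissible M i j a ->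
  measurable (cylinder i j a `*` setT : set (X * Z)).
Proof. by move=> ij aM; apply: measurableX => //; exact: measurable_cylinder. Qed.

Definition local (n : nat) (D : set (X * Z)) :=
  forall x y z, ball_of n x y -> D (x, z) -> D (y, z).

Lemma local_le m n D : (m <= n)%N -> local m D -> local n D.
Proof. by move=> mn lD x y z /(ball_le mn); exact: lD. Qed.

Definition local_algebra : set (set (X * Z)) :=
  [set D | measurable D /\ exists n, local n D].

Lemma local_algebra_measurable : local_algebra `<=` measurable.
Proof. by move=> D []. Qed.

Lemma local_algebra0 : local_algebra set0.
Proof. by split; [exact: measurable0|exists 0%N]. Qed.

Lemma local_algebraC D : local_algebra D -> local_algebra (~` D).
Proof.
move=> [mD [n lD]]; split; first exact: measurableC.
by exists n => x y z /ball_sym xy nD Dy; apply: nD; exact: lD Dy.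
Qed.

Lemma local_algebraU D E :
  local_algebra D -> local_algebra E -> local_algebra (D `|` E).
Proof.
move=> [mD [n lD]] [mE [k lE]]; split; first exact: measurableU.
exists (maxn n k) => x y z xy [Dx|Ex]; [left|right].
  exact: (local_le (leq_maxl n k) lD xy).
exact: (local_le (leq_maxr n k) lE xy).
Qed.

(** The rectangle A x B is the intersection of A x Z and X x B.  The latter is
    local, and the sets A for which the former is generated form a sigma-algebra
    that contains the cylinders. *)
Lemma local_algebra_generates : measurable `<=` <<s local_algebra >>.
Proof.
rewrite measurable_prod_measurableType.
have sa := smallest_sigma_algebra setT local_algebra.
have [s0 sC sU] := sa.
apply: smallest_sub => // _ [A mA [B mB <-]].
have -> : A `*` B = ~` (~` (A `*` setT) `|` ~` (setT `*` B)).
  rewrite setCU !setCK; apply/seteqP; split=> [[x z] []//|[x z] [[? _] [_ ?]]//].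
have cC D : <<s local_algebra >> D -> <<s local_algebra >> (~` D).
  by rewrite -setTD; exact: sC.
have cU D E : <<s local_algebra >> D -> <<s local_algebra >> E ->
    <<s local_algebra >> (D `|` E).
  move=> sD sE; rewrite -bigcup2E; apply: sU => -[|[|n]] //.
apply: (cC); apply: (cU); apply: (cC).
  move: A mA {s0 sC}; apply: smallest_sub.
    split.
    - by rewrite set0X; case: sa.
    - move=> A sA; rewrite (_ : _ `*` _ = ~` (A `*` setT)); first exact: cC.
      by apply/seteqP; split=> [[x z] [[_ nA] _] [Ax _]//|[x z] /= nA]; split=> //;
        split=> // Ax; apply: nA.
    - by move=> F sF; rewrite setX_bigcupl; exact: sU.
  move=> C [i [j [a [ij aM ->]]]]; apply: sub_sigma_algebra; split.
    by apply: measurableX => //; exact: measurable_cylinder.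
  exists (maxn (absz i) (absz j)) => x y z xy [Cx _]; split=> // l l1 l2.
  by rewrite xy ?Cx//; lia.
apply: sub_sigma_algebra; split; first exact: measurableX.
by exists 0%N => x y z _ [_ Bz].
Qed.

Variable R : realType.

(** A local set is a disjoint union of products of a ball with a section, so the
    inequality holds on the algebra of local sets; the general case follows by
    approximation in rho1 + rho2. *)
Lemma le_measure_ball (rho1 rho2 : {measure set (X * Z) -> \bar R})
    (c1 c2 : R) (n0 : nat) :
  (rho1 setT < +oo)%E -> (rho2 setT < +oo)%E -> 0 <= c1 -> 0 <= c2 ->
  (forall n x F, (n0 <= n)%N -> measurable F ->
    (c1%:E * rho1 (ball_of n x `*` F) <= c2%:E * rho2 (ball_of n x `*` F))%E) ->
  forall E, measurable E -> (c1%:E * rho1 E <= c2%:E * rho2 E)%E.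
Proof.
move=> fin1 fin2 c10 c20 hball.
have hloc D : local_algebra D -> (c1%:E * rho1 D <= c2%:E * rho2 D)%E.
  move=> [mD [k lD]]; pose n := maxn k n0.
  have {}lD : local n D by apply: (local_le _ lD); exact: leq_maxl.
  pose g (p : X * Z) := word n p.1.
  have mg w : measurable (g @^-1` [set w]).
    rewrite (_ : _ @^-1` _ = (word n @^-1` [set w]) `*` setT).
      by apply: measurableX => //; exact: measurable_word.
    by apply/seteqP; split=> [[x z] //=|[x z] [//]].
  rewrite (fibre_sum rho1 mD mg) (fibre_sum rho2 mD mg).
  rewrite !ge0_sume_distrr; [|by move=> *; exact: measure_ge0..].
  apply: lee_sum => w _.
  have [w0|[x xw]] := word_fibre w.
    rewrite (_ : D `&` _ = set0) ?measure0 ?mule0//.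
    apply/seteqP; split=> // -[y z] [_ gy].
    by have : (word n @^-1` [set w]) y by []; rewrite w0.
  rewrite (_ : D `&` _ = ball_of n x `*` xsection D x).
    apply: hball; first exact: leq_maxr.
    exact: measurable_xsection.
  apply/seteqP; split=> -[y z] /=.
    move=> [Dy gy]; have xy : ball_of n x y by rewrite -xw.
    by split=> //; rewrite /xsection/= inE; apply: lD Dy; exact: ball_sym.
  rewrite /xsection/= inE => -[xy Dx]; split; first exact: lD Dx.
  by have : (word n @^-1` [set w]) y by rewrite xw.
move=> E mE; apply/lee_addgt0Pr => e e0.
pose e' := e / (c1 + c2 + 1).
have cc : 0 < c1 + c2 + 1 by rewrite ltr_wpDl// addr_ge0.
have e'0 : 0 < e' by rewrite divr_gt0.
have finA : (measure_add rho1 rho2 setT < +oo)%E.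
  by rewrite measure_addE lte_add_pinfty.
have sE := local_algebra_generates mE.
have [D [LD ED DE]] := algebra_approx finA local_algebra_measurable local_algebra0
  local_algebraC local_algebraU sE e'0.
have mD := LD.1.
have add_le1 A : (rho1 A <= measure_add rho1 rho2 A)%E.
  by rewrite measure_addE leeDl.
have add_le2 A : (rho2 A <= measure_add rho1 rho2 A)%E.
  by rewrite measure_addE leeDr.
have split_le (rho : {measure set (X * Z) -> \bar R}) A B : measurable A ->
    measurable B -> (rho (A `\` B) <= e'%:E)%E -> (rho A <= rho B + e'%:E)%E.
  move=> mA mB h; apply: le_trans (leeD (lexx _) h).
  apply: le_trans (measureU2 _ _ _) => //; last exact: measurableD.
  rewrite le_measure ?inE//; first by apply: measurableU => //; exact: measurableD.
  by move=> y Ay; have [By|nB] := pselect (B y); [left|right].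
have h1 := split_le rho1 E D mE mD (le_trans (add_le1 _) ED).
have h2 := split_le rho2 D E mD mE (le_trans (add_le2 _) DE).
apply: (@le_trans _ _ (c1%:E * (rho1 D + e'%:E))%E).
  by rewrite lee_wpmul2l// lee_fin.
have e'E : (0 <= e'%:E)%E by rewrite lee_fin ltW.
rewrite ge0_muleDr//.
apply: (@le_trans _ _ (c2%:E * (rho2 E + e'%:E) + c1%:E * e'%:E)%E).
  rewrite leeD2r//; apply: (le_trans (hloc D LD)).
  by rewrite lee_wpmul2l// lee_fin.
rewrite ge0_muleDr// -addeA leeD2l// -!EFinM -EFinD lee_fin.
rewrite -mulrDl /e' mulrA ler_pdivrMr// mulrC ler_wpM2l//; first exact: ltW.
by rewrite addrC lerDl.
Qed.

End Local.

End Balls.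
Arguments measurable_window {S M S0 prM d} Z {i j a}.

(** * Exchanging two words with the same end letters *)

Definition splice (S : Type) (i j : int) (u x : int -> S) (l : int) : S :=
  if (i <= l) && (l <= j) then u l else x l.

Section Swap.
Variables (S : finType) (M : rel S) (S0 : (0 < #|S|)%N) (prM : primitive M).
Local Notation X := (markov_shift S0 prM).
Implicit Types (i j : int) (u v : int -> S) (x y : X).

Lemma spliceT i j u (x : int -> S) l : i <= l -> l <= j -> splice i j u x l = u l.
Proof. by move=> il lj; rewrite /splice il lj. Qed.

Lemma spliceF i j u (x : int -> S) l : l < i \/ j < l -> splice i j u x l = x l.
Proof. by move=> h; rewrite /splice; case: ifP => //; lia. Qed.

Lemma splice_admissible i j u x : i <= j -> admissible M i j u ->
  u i = sval x i -> u j = sval x j -> splice i j u (sval x) \in shift_space M.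
Proof.
move=> ij uM ui uj; rewrite inE => l.
have xl := shiftspace_step x l.
have [li|il] := ltP l i.
  rewrite [splice _ _ _ _ l]spliceF; last by left.
  have [li'|il'] := ltP (l + 1) i; first by rewrite spliceF//; left.
  have e : l + 1 = i by lia.
  by rewrite spliceT; [rewrite e ui -e|lia|lia].
have [jl|lj] := ltP j l.
  by rewrite !spliceF//; right; lia.
rewrite [splice _ _ _ _ l]spliceT//.
have [lj'|jl'] := ltP l j.
  by rewrite spliceT; [exact: uM|lia|lia].
have e : l = j by lia.
by rewrite spliceF; [rewrite e uj -e|right; lia].
Qed.

(** When the words of [swap] are exchangeable, the spliced sequence is in the
    shift space; the second branch makes the map total. *)
Definition splice_pt i j u x : X :=
  match pselect (splice i j u (sval x) \in shift_space M) with
  | left h => exist (fun z : int -> S => z \in shift_space M) _ h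
  | right _ => x
  end.

Definition swap i j u v x : X :=
  if `[< cylinder i j u x >] then splice_pt i j v x
  else if `[< cylinder i j v x >] then splice_pt i j u x else x.

Definition exchangeable i j u v :=
  [/\ i <= j, admissible M i j u, admissible M i j v, u i = v i & u j = v j].

Lemma exchangeableC i j u v : exchangeable i j u v -> exchangeable i j v u.
Proof. by case. Qed.

Section Exchangeable.
Variables (i j : int) (u v : int -> S).
Hypothesis uv : exchangeable i j u v.

Let swp := swap i j u v.

Let splice_ptE a b x : exchangeable i j a b -> cylinder i j a x ->
  sval (splice_pt i j b x) = splice i j b (sval x).
Proof.
move=> [ij aM bM abi abj] ax; rewrite /splice_pt; case: pselect => //= -[].
by apply: splice_admissible => //; rewrite ax.
Qed.

Lemma swap_left x : cylinder i j u x -> sval (swp x) = splice i j v (sval x).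
Proof. by move=> ux; rewrite /swp /swap asboolT// (splice_ptE uv). Qed.

Lemma swap_right x : cylinder i j v x -> sval (swp x) = splice i j u (sval x).
Proof.
move=> vx; rewrite /swp /swap; case: asboolP => [ux|_].
  rewrite (splice_ptE uv)//; apply/funext => l; rewrite /splice.
  by case: ifP => // /andP[il lj]; rewrite -ux// vx.
by rewrite asboolT// (splice_ptE (exchangeableC uv)).
Qed.

Lemma swap_id x : ~ cylinder i j u x -> ~ cylinder i j v x -> swp x = x.
Proof. by move=> nu nv; rewrite /swp /swap !asboolF. Qed.

Lemma swap_cyl_left x : cylinder i j u x -> cylinder i j v (swp x).
Proof. by move=> ux l il lj; rewrite swap_left// spliceT. Qed.

Lemma swap_cyl_right x : cylinder i j v x -> cylinder i j u (swp x).
Proof. by move=> vx l il lj; rewrite swap_right// spliceT. Qed.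

Lemma swap_out x l : l < i \/ j < l -> sval (swp x) l = sval x l.
Proof.
move=> h; have [ux|nu] := pselect (cylinder i j u x).
  by rewrite swap_left// spliceF.
have [vx|nv] := pselect (cylinder i j v x).
  by rewrite swap_right// spliceF.
by rewrite swap_id.
Qed.

Lemma swapK : involutive swp.
Proof.
move=> x; apply: markov_shift_eq => l.
have [ux|nu] := pselect (cylinder i j u x).
  rewrite swap_right; last exact: swap_cyl_left.
  rewrite swap_left// /splice; have [/andP[il lj]|//] := boolP (_ && _).
  by rewrite ux.
have [vx|nv] := pselect (cylinder i j v x).
  rewrite swap_left; last exact: swap_cyl_right.
  rewrite swap_right// /splice; have [/andP[il lj]|//] := boolP (_ && _).
  by rewrite vx.
by rewrite !swap_id.
Qed.

Lemma ball_swap n x y : - n%:Z <= i -> j <= n%:Z ->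
  ball_of n x y -> ball_of n (swp x) (swp y).
Proof.
move=> ni jn xy.
have cyl a (z t : X) : ball_of n z t -> cylinder i j a z -> cylinder i j a t.
  by move=> zt az l il lj; rewrite zt; [exact: az|lia|lia].
move=> l l1 l2.
have [ux|nu] := pselect (cylinder i j u x).
  by rewrite !swap_left//; [rewrite /splice xy|exact: (cyl _ _ _ xy)].
have nuy : ~ cylinder i j u y by move=> /(cyl _ _ _ (ball_sym xy)).
have [vx|nv] := pselect (cylinder i j v x).
  by rewrite !swap_right//; [rewrite /splice xy|exact: (cyl _ _ _ xy)].
have nvy : ~ cylinder i j v y by move=> /(cyl _ _ _ (ball_sym xy)).
by rewrite !swap_id// xy.
Qed.

(** The preimage of a cylinder depends on finitely many coordinates, because the
    swap maps balls that contain its window into balls. *)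
Lemma measurable_swap : measurable_fun setT swp.
Proof.
apply: (@measurability _ _ _ _ _ _ (@cylinders S M S0 prM)) => //.
move=> _ [_ [k [l [a [kl aM ->]]]] <-]; rewrite setTI.
pose n := maxn (maxn (absz i) (absz j)) (maxn (absz k) (absz l)).
apply: (@measurable_ball_invariant _ _ _ _ n) => x y xy /= h p kp pl.
have b : ball_of n (swp x) (swp y) by apply: ball_swap => //; lia.
by rewrite b ?h//; lia.
Qed.

Lemma swapC : swap i j v u =1 swp.
Proof.
move=> x; apply: markov_shift_eq => l.
have [ux|nu] := pselect (cylinder i j u x).
  rewrite swap_left// /swap (asboolT ux); case: asboolP => [vx|_].
    rewrite (splice_ptE (exchangeableC uv))// /splice.
    by have [/andP[il lj]|//] := boolP (_ && _); rewrite -vx// ux.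
  by rewrite (splice_ptE uv).
have [vx|nv] := pselect (cylinder i j v x).
  by rewrite swap_right// /swap asboolT// (splice_ptE (exchangeableC uv)).
by rewrite swap_id// /swap !asboolF.
Qed.

End Exchangeable.

Local Notation T := (left_shift S0 prM).

Lemma sval_iter_shift k x l : sval (iter k T x) l = sval x (l + k%:Z).
Proof.
elim: k x l => [|k ih] x l; first by rewrite addr0.
by rewrite iterSr ih /=; congr (sval x _); lia.
Qed.

Lemma sval_iter_shift_inv k x l : sval (iter k (aut_inv T) x) l = sval x (l - k%:Z).
Proof.
elim: k x l => [|k ih] x l; first by rewrite subr0.
by rewrite iterSr ih /=; congr (sval x _); lia.
Qed.

Definition translate (k : nat) (u : int -> S) (l : int) : S := u (l + k%:Z).

Lemma exchangeable_translate k i j u v : exchangeable i j u v ->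
  exchangeable (i - k%:Z) (j - k%:Z) (translate k u) (translate k v).
Proof.
move=> [ij uM vM ui uj]; split; rewrite /translate ?subrK//; first by lia.
- by move=> l l1 l2; rewrite addrAC; apply: uM; lia.
- by move=> l l1 l2; rewrite addrAC; apply: vM; lia.
Qed.

(** The conjugate of a swap by a power of the shift is a swap of the same length
    at another place. *)
Lemma swap_shift_inv k i j u v x : exchangeable i j u v ->
  swap i j u v (iter k (aut_inv T) x) = iter k (aut_inv T)
    (swap (i - k%:Z) (j - k%:Z) (translate k u) (translate k v) x).
Proof.
move=> uv; have uvk := exchangeable_translate k uv.
have cyl a : cylinder i j a (iter k (aut_inv T) x) <->
    cylinder (i - k%:Z) (j - k%:Z) (translate k a) x.
  split=> h l l1 l2.
    by rewrite /translate -h ?sval_iter_shift_inv ?addrK//; lia.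
  rewrite sval_iter_shift_inv h; [|lia|lia].
  by rewrite /translate subrK.
apply: markov_shift_eq => l; rewrite sval_iter_shift_inv.
have spl a (z : int -> S) : splice i j a (fun l => z (l - k%:Z)) l =
    splice (i - k%:Z) (j - k%:Z) (translate k a) z (l - k%:Z).
  by rewrite /splice /translate subrK !lerD2r.
have sv : sval (iter k (aut_inv T) x) = fun l => sval x (l - k%:Z).
  by apply/funext => p; rewrite sval_iter_shift_inv.
have [ux|nu] := pselect (cylinder i j u (iter k (aut_inv T) x)).
  rewrite (swap_left uv ux) (swap_left uvk); last exact/cyl.
  by rewrite sv spl.
have nuk := contra_not (cyl u).2 nu.
have [vx|nv] := pselect (cylinder i j v (iter k (aut_inv T) x)).
  rewrite (swap_right uv vx) (swap_right uvk); last exact/cyl.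
  by rewrite sv spl.
have nvk := contra_not (cyl v).2 nv.
by rewrite (swap_id nu nv) (swap_id nuk nvk) sval_iter_shift_inv.
Qed.

End Swap.

(** * Swaps and the Markov measure *)

Section PathWeight.
Variables (R : realType) (S : finType) (P : int -> S -> S -> R).

Definition path_weight (u : int -> S) (i : int) (L : nat) : R :=
  \prod_(k < L) P (i + k%:Z) (u (i + k%:Z)) (u (i + k%:Z + 1)).

Lemma path_weight_cat u i L1 L2 : path_weight u i (L1 + L2) =
  path_weight u i L1 * path_weight u (i + L1%:Z) L2.
Proof.
rewrite /path_weight big_split_ord /=; congr (_ * _).
by apply: eq_bigr => k _; rewrite PoszD addrA.
Qed.

Lemma eq_path_weight u v i L :
  (forall l, i <= l -> l <= i + L%:Z -> u l = v l) ->
  path_weight u i L = path_weight v i L.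
Proof.
by move=> uv; apply: eq_bigr => -[k kL] _ /=; rewrite !uv//; lia.
Qed.

Variables (M : rel S) (delta : R).
Hypothesis P_stoch : forall n : int, row_stochastic (P n).
Hypothesis delta0 : 0 < delta.
Hypothesis P_ge : forall n a b, M a b -> delta <= P n a b.

Lemma P_ge0 n a b : 0 <= P n a b.
Proof. by have [h _] := P_stoch n a; exact: h. Qed.

Lemma P_le1 n a b : P n a b <= 1.
Proof.
have [h <-] := P_stoch n a; rewrite (bigD1 b)//= lerDl.
by apply: sumr_ge0 => c _; exact: h.
Qed.

Lemma path_weight_le1 u i L : path_weight u i L <= 1.
Proof. by apply: prodr_ile1 => k _; rewrite P_ge0 P_le1. Qed.

Lemma path_weight_ge0 u i L : 0 <= path_weight u i L.
Proof. by apply: prodr_ge0 => k _; exact: P_ge0. Qed.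

Lemma path_weight_ge u i L : admissible M i (i + L%:Z) u ->
  delta ^+ L <= path_weight u i L.
Proof.
move=> uM; rewrite -[L in delta ^+ L]card_ord -prodr_const.
apply: ler_prod => k _; rewrite (ltW delta0)/=; apply: P_ge; apply: uM.
  by rewrite lerDl.
by have := ltn_ord k; lia.
Qed.

Lemma path_weight_gt0 u i L : admissible M i (i + L%:Z) u ->
  0 < path_weight u i L.
Proof. by move=> /path_weight_ge; apply: lt_le_trans; exact: exprn_gt0. Qed.

End PathWeight.

Section SwapMeasure.
Variables (R : realType) (S : finType) (M : rel S).
Variables (S0 : (0 < #|S|)%N) (prM : primitive M).
Variables (pi_ : int -> S -> R) (P : int -> S -> S -> R).
Hypothesis P_stoch : forall n : int, row_stochastic (P n).
Variable mu : probability (markov_shift S0 prM) R.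
Hypothesis mu_markov : markov_measure pi_ P mu.
Local Notation X := (markov_shift S0 prM).

Lemma mu_cylinder i L (u : int -> S) : admissible M i (i + L%:Z) u ->
  mu (cylinder i (i + L%:Z) u) = (pi_ i (u i) * path_weight P u i L)%:E.
Proof.
move=> uM; rewrite mu_markov//; last by lia.
by rewrite (_ : absz (i + L%:Z - i)%R = L)//; lia.
Qed.

Lemma mu_ball n (x : X) : mu (ball_of n x) =
  (pi_ (- n%:Z) (sval x (- n%:Z)) * path_weight P (sval x) (- n%:Z) (n + n))%:E.
Proof.
rewrite /ball_of (_ : n%:Z = - n%:Z + (n + n)%N%:Z) ?[in LHS]opprD; last by lia.
rewrite -mu_cylinder; last exact: admissible_sval.
by congr (mu (cylinder _ _ _)); lia.
Qed.

Section OneSwap.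
Variables (i : int) (L : nat) (u v : int -> S).
Local Notation j := (i + L%:Z).
Hypothesis uv : exchangeable M i j u v.
Local Notation swp := (@swap S M S0 prM i j u v).

(** Only the transition probabilities inside the window change: the factors on
    both sides are the same, since the end letters of u and v agree, and so is
    the initial probability, even if the window begins at - n. *)
Lemma mu_ball_swap n (x : X) : - n%:Z <= i -> j <= n%:Z -> cylinder i j v x ->
  path_weight P v i L * fine (mu (ball_of n (swp x))) =
  path_weight P u i L * fine (mu (ball_of n x)).
Proof.
move=> ni jn vx; rewrite !mu_ball/=.
have [ij uM vM uvi uvj] := uv.
have out l : l <= i \/ j <= l -> sval (swp x) l = sval x l.
  move=> h; have [->|li] := eqVneq l i.
    by rewrite (swap_right uv vx) spliceT// uvi vx.
  have [->|lj] := eqVneq l j.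
    by rewrite (swap_right uv vx) spliceT// uvj vx.
  by apply: (swap_out uv); case: h => h; [left|right]; lia.
pose a := absz (i + n%:Z); pose b := absz (n%:Z - j)%R.
have -> : (n + n)%N = (a + (L + b))%N by lia.
rewrite !path_weight_cat.
have -> : - n%:Z + a%:Z = i by lia.
rewrite (@eq_path_weight _ _ _ (sval (swp x)) (sval x) (- n%:Z) a); last first.
  by move=> l _ h; apply: out; left; lia.
rewrite (@eq_path_weight _ _ _ (sval (swp x)) (sval x) j b); last first.
  by move=> l h _; apply: out; right; lia.
rewrite (@eq_path_weight _ _ _ (sval (swp x)) u i L); last first.
  by move=> l il lj; rewrite (swap_right uv vx) spliceT.
rewrite (@eq_path_weight _ _ _ (sval x) v i L); last first.
  by move=> l il lj; rewrite vx.
by rewrite out; [ring|left].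
Qed.

Variables (d : measure_display) (Z : measurableType d) (m : probability Z R).
Let nu : probability (X * Z)%type R := (mu \x m)%E.

Definition swap_fst (p : X * Z) : X * Z := (swp p.1, p.2).

Lemma measurable_swap_fst : measurable_fun setT swap_fst.
Proof.
apply: measurable_fun_pair => //.
exact: (measurableT_comp (measurable_swap uv)).
Qed.

Lemma swap_fstK : involutive swap_fst.
Proof. by case=> x z; rewrite /swap_fst/= swapK. Qed.

Let nuX (A : set X) (F : set Z) : measurable A -> measurable F ->
  nu (A `*` F) = (mu A * m F)%E.
Proof. by move=> mA mF; exact: product_measure1E. Qed.

(** Both sides are finite measures in E; on products of balls with measurable
    sets they agree by [mu_ball_swap]. *)
Lemma swap_exchange (E : set (X * Z)) : measurable E ->
  ((path_weight P v i L)%:E * nu (swap_fst @^-1` (E `&` (cylinder i j v `*` setT))) =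
   (path_weight P u i L)%:E * nu (E `&` (cylinder i j v `*` setT)))%E.
Proof.
move=> mE; have [ij uM vM uvi uvj] := uv.
have mV := @measurable_window _ _ S0 prM _ Z _ _ _ ij vM.
pose PhiM : {mfun (X * Z)%type >-> (X * Z)%type} :=
  HB.pack swap_fst (isMeasurableFun.Build _ _ _ _ _ measurable_swap_fst).
pose rho1 : {measure set (X * Z)%type -> \bar R} := mrestr (distribution nu PhiM) mV.
pose rho2 : {measure set (X * Z)%type -> \bar R} := mrestr nu mV.
have fin1 : (rho1 setT < +oo)%E.
  apply: (@le_lt_trans _ _ 1%E); last exact: ltry.
  by apply: (@probability_le1 _ _ _ (distribution nu PhiM)); exact: measurableI.
have fin2 : (rho2 setT < +oo)%E.
  apply: (@le_lt_trans _ _ 1%E); last exact: ltry.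
  by apply: (@probability_le1 _ _ _ nu); exact: measurableI.
have wu0 := path_weight_ge0 P_stoch u i L.
have wv0 := path_weight_ge0 P_stoch v i L.
pose n0 := maxn (absz i) (absz j).
have key n (x : X) (F : set Z) : (n0 <= n)%N -> measurable F ->
    ((path_weight P v i L)%:E * rho1 (ball_of n x `*` F) =
     (path_weight P u i L)%:E * rho2 (ball_of n x `*` F))%E.
  move=> nn mF; have ni : - n%:Z <= i by lia. have jn : j <= n%:Z by lia.
  change ((path_weight P v i L)%:E *
      nu (swap_fst @^-1` ((ball_of n x `*` F) `&` (cylinder i j v `*` setT))) =
    (path_weight P u i L)%:E *
      nu ((ball_of n x `*` F) `&` (cylinder i j v `*` setT)))%E.
  have [vx|nvx] := pselect (cylinder i j v x); last first.
    rewrite (_ : (_ `*` F) `&` _ = set0) ?preimage_set0 ?measure0 ?mule0//.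
    apply/seteqP; split=> // -[y z] [[xy _] [vy _]]; apply: nvx => l il lj.
    by rewrite -vy// xy//; lia.
  have e0 : (ball_of n x `*` F) `&` (cylinder i j v `*` setT) = ball_of n x `*` F.
    apply/setIidPl => -[y z] [xy _]; split=> // l il lj.
    by rewrite xy ?vx//; lia.
  rewrite e0.
  have -> : swap_fst @^-1` (ball_of n x `*` F) = ball_of n (swp x) `*` F.
    apply/seteqP; split=> -[y z] [/= xy Fz]; split=> //=.
      by rewrite -(swapK uv y); exact: (ball_swap uv).
    by rewrite -(swapK uv x); exact: (ball_swap uv).
  rewrite !nuX//; try exact: measurable_ball.
  rewrite !muleA; congr (_ * _)%E.
  rewrite -[mu (ball_of n (swp x))]fineK ?fin_num_measure//; last exact: measurable_ball.
  rewrite -[mu (ball_of n x)]fineK ?fin_num_measure//; last exact: measurable_ball.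
  by rewrite -!EFinM; congr EFin; exact: mu_ball_swap.
apply/eqP; rewrite eq_le; apply/andP; split.
  apply: (@le_measure_ball _ _ _ _ _ _ _ rho1 rho2 _ _ n0) => // n x F nn mF.
  by rewrite key.
apply: (@le_measure_ball _ _ _ _ _ _ _ rho2 rho1 _ _ n0) => // n x F nn mF.
by rewrite key.
Qed.

End OneSwap.

End SwapMeasure.
Arguments swap_fst {S M S0 prM} i L u v {d Z} p.

(** * Invariant sets do not see finitely many coordinates *)

Section Primitive.
Variables (S : finType) (M : rel S).

Lemma adj_mx_path n (a b : S) :
  (0 < (adj_mx M ^+ n) (enum_rank a) (enum_rank b))%N ->
  exists p : nat -> S, [/\ p 0%N = a, p n = b &
    forall k, (k < n)%N -> M (p k) (p k.+1)].
Proof.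
elim: n a => [|n ih] a.
  rewrite expr0 -[1]/(1%:M) mxE.
  have [ab _|] := eqVneq (enum_rank a) (enum_rank b).
    by exists (fun=> a); split=> //; exact: enum_rank_inj.
  by rewrite mulr0n.
rewrite exprS -mulmxE mxE => pos.
have [c Mac cb] : exists2 c, M a c &
    (0 < (adj_mx M ^+ n) (enum_rank c) (enum_rank b))%N.
  apply: contrapT => nc; move: pos; rewrite big1// => k _.
  rewrite -(enum_valK k) mxE !enum_rankK.
  case Mak : (M a (enum_val k)); last by rewrite mul0r.
  rewrite mul1r; apply/eqP; rewrite -leqn0 leqNgt; apply/negP => h.
  by apply: nc; exists (enum_val k).
have [p [p0 pn pM]] := ih c cb.
exists (fun k => if k is k'.+1 then p k' else a); split=> // -[_|k kn].
  by rewrite p0.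
exact: pM.
Qed.

Lemma primitive_path : primitive M -> exists N : nat, forall (i : int) (a b : S),
  exists u : int -> S, [/\ admissible M i (i + N%:Z) u, u i = a &
    u (i + N%:Z) = b].
Proof.
move=> [N _ posN]; exists N => i a b.
have [p [p0 pN pM]] := adj_mx_path (posN a b).
exists (fun l => p (absz (l - i)%R)); split.
- move=> l il lj; rewrite (_ : absz (l + 1 - i)%R = (absz (l - i)%R).+1); last by lia.
  by apply: pM; lia.
- by rewrite subrr.
- by rewrite (_ : absz (i + N%:Z - i)%R = N)//; lia.
Qed.

End Primitive.

Section Exchange.
Variables (R : realType) (S : finType) (M : rel S).
Variables (S0 : (0 < #|S|)%N) (prM : primitive M).
Variables (pi_ : int -> S -> R) (P : int -> S -> S -> R) (delta : R).
Hypothesis pi_prob : forall n : int, prob_vector (pi_ n).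
Hypothesis P_stoch : forall n : int, row_stochastic (P n).
Hypothesis delta0 : 0 < delta.
Hypothesis P_ge : forall n a b, M a b -> delta <= P n a b.
Variable mu : probability (markov_shift S0 prM) R.
Hypothesis mu_markov : markov_measure pi_ P mu.
Local Notation X := (markov_shift S0 prM).
Local Notation T := (left_shift S0 prM).
Variables (d : measure_display) (Z : measurableType d) (m : probability Z R).
Let nu : probability (X * Z)%type R := (mu \x m)%E.

(** By [swap_exchange] a swap multiplies the measure of a set by a quotient of two
    path weights, which lies between delta ^ L and delta ^- L.  Exchanging the
    roles of the words handles the other window; everywhere else the swap is
    the identity.  The bound depends on the length of the window and not on
    its position. *)
Lemma swap_bound i L u v (E : set (X * Z)) : exchangeable M i (i + L%:Z) u v ->
  measurable E ->
  (nu (swap_fst i L u v @^-1` E) <= (2 * delta ^- L + 1)%:E * nu E)%E.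
Proof.
move=> uv mE; have vu := exchangeableC uv.
have half a b : exchangeable M i (i + L%:Z) a b ->
    (nu (swap_fst i L a b @^-1` (E `&` (cylinder i (i + L%:Z) b `*` setT))) <=
      (delta ^- L)%:E * nu E)%E.
  move=> ab; have [ij _ bM _ _] := ab.
  have mV := @measurable_window _ _ S0 prM _ Z _ _ _ ij bM.
  have mI := measurableI _ _ mE mV.
  have wb := path_weight_gt0 delta0 P_ge bM.
  have := swap_exchange P_stoch mu_markov ab m mE.
  rewrite -/nu => h; rewrite lee_pdivlMl ?exprn_gt0//.
  apply: (@le_trans _ _ ((path_weight P b i L)%:E *
      nu (swap_fst i L a b @^-1` (E `&` (cylinder i (i + L%:Z) b `*` setT))))%E).
    by rewrite lee_wpmul2r// lee_fin; exact: (path_weight_ge delta0 P_ge bM).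
  rewrite h -[leRHS]mul1e lee_pmul// ?lee_fin.
  - exact: path_weight_ge0.
  - exact: path_weight_le1.
  - by rewrite le_measure ?inE.
have [ij uM vM _ _] := uv.
pose V1 := swap_fst i L u v @^-1` (E `&` (cylinder i (i + L%:Z) v `*` setT)) : set (X * Z).
pose V2 := swap_fst i L u v @^-1` (E `&` (cylinder i (i + L%:Z) u `*` setT)) : set (X * Z).
have mV1 : measurable V1.
  apply: measurable_preimage; first exact: measurable_swap_fst.
  by apply: measurableI => //; exact: measurable_window.
have mV2 : measurable V2.
  apply: measurable_preimage; first exact: measurable_swap_fst.
  by apply: measurableI => //; exact: measurable_window.
have h2 : (nu V2 <= (delta ^- L)%:E * nu E)%E.
  apply: le_trans (half _ _ vu); rewrite le_eqVlt; apply/orP; left; apply/eqP.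
  by congr (nu _); apply/seteqP; split=> -[x z]; rewrite /V2/= /swap_fst/= (swapC uv).
apply: (@le_trans _ _ (nu (V1 `|` V2 `|` E))).
  rewrite le_measure ?inE//.
  - apply: measurable_preimage => //; exact: measurable_swap_fst.
  - by apply: measurableU => //; exact: measurableU.
  - move=> [x z] /= Ep.
    have [vx|nv] := pselect (cylinder i (i + L%:Z) v (swap i (i + L%:Z) u v x)).
      by left; left.
    have [ux|nu'] := pselect (cylinder i (i + L%:Z) u (swap i (i + L%:Z) u v x)).
      by left; right.
    right; move: Ep; rewrite /swap_fst/= swap_id//.
      by move=> /(swap_cyl_left uv).
    by move=> /(swap_cyl_right uv).
rewrite EFinD ge0_muleDl; [|by rewrite lee_fin mulr_ge0// invr_ge0 exprn_ge0 ?ltW..|by []].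
rewrite mul1e; apply: (le_trans (measureU2 _ (measurableU _ _ mV1 mV2) mE)).
rewrite leeD2r//; apply: (le_trans (measureU2 _ mV1 mV2)).
rewrite mulr_natl mulr2n EFinD ge0_muleDl; last 2 first.
- by rewrite lee_fin invr_ge0 exprn_ge0// ltW.
- by rewrite lee_fin invr_ge0 exprn_ge0// ltW.
by apply: leeD => //; exact: half.
Qed.

Variable Q : borel_aut Z.
Hypotheses (nsT : nonsingular mu T) (cT : conservative mu T).
Hypothesis pQ : measure_preserving m Q.

(** [hopf_exchange] applies: conjugating by powers of the shift translates the
    window and leaves the bound of [swap_bound] unchanged, and a local set is
    not affected by the window once it has been shifted out of sight. *)
Lemma invariant_swap (A : set (X * Z)) i L u v : measurable A ->
  prod_aut T Q @^-1` A = A -> exchangeable M i (i + L%:Z) u v ->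
  nu (A `&` swap_fst i L u v @^-1` (~` A)) = 0%E.
Proof.
move=> mA invA uv.
have [w jw] := nonsingular_jacobian nsT.
have jw' := prod_jacobian jw pQ.
apply: (@hopf_exchange _ _ _ nu (prod_aut T Q) (w \o fst) jw' _ _
    (2 * delta ^- L + 1)) => //.
- exact: (prod_diverge _ _ (weight_diverge nsT cT jw)).
- exact: measurable_swap_fst.
- exact: swap_fstK.
- move=> k E mE.
  have -> : swap_fst i L u v \o iter k (aut_inv (prod_aut T Q)) =
      iter k (aut_inv (prod_aut T Q)) \o
        swap_fst (i - k%:Z) L (translate k u) (translate k v).
    apply/funext => -[x z].
    rewrite /comp !iter_prod_aut_inv /swap_fst /fst /snd.
    by rewrite (swap_shift_inv _ _ uv) addrAC.
  rewrite -[X in nu X]/(swap_fst (i - k%:Z) L (translate k u) (translate k v) @^-1`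
        (iter k (aut_inv (prod_aut T Q)) @^-1` E)).
  apply: swap_bound; first by rewrite addrAC; exact: exchangeable_translate.
  apply: measurable_preimage => //.
  exact: (measurable_iter (measurable_aut_inv (prod_aut T Q))).
- move=> B e mB e0.
  have nufin : (nu setT < +oo)%E by rewrite ltey_eq fin_num_measure.
  have [D [[mD [n lD]] BD DB]] := algebra_approx nufin
    (@local_algebra_measurable _ _ S0 prM _ Z)
    (@local_algebra0 _ _ S0 prM _ Z) (@local_algebraC _ _ S0 prM _ Z)
    (@local_algebraU _ _ S0 prM _ Z) (local_algebra_generates mB) e0.
  exists D; split=> //; exists (absz (i + L%:Z)%R + n).+1 => k [x z] kN.
  rewrite !iter_prod_aut /swap_fst/=.
  have b : ball_of n (iter k T x) (iter k T (swap i (i + L%:Z) u v x)).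
    move=> l l1 l2; rewrite !sval_iter_shift (swap_out uv)//; right; lia.
  split=> h; first exact: lD (ball_sym b) h.
  exact: lD b h.
Qed.

End Exchange.

(** * Quasi-independence of an invariant set and a word *)

Section Mixing.
Variables (R : realType) (S : finType) (M : rel S).
Variables (S0 : (0 < #|S|)%N) (prM : primitive M).
Variables (pi_ : int -> S -> R) (P : int -> S -> S -> R) (delta : R).
Hypothesis pi_prob : forall n : int, prob_vector (pi_ n).
Hypothesis P_stoch : forall n : int, row_stochastic (P n).
Hypothesis delta0 : 0 < delta.
Hypothesis P_ge : forall n a b, M a b -> delta <= P n a b.
Variable mu : probability (markov_shift S0 prM) R.
Hypothesis mu_markov : markov_measure pi_ P mu.
Local Notation X := (markov_shift S0 prM).
Variables (d : measure_display) (Z : measurableType d) (m : probability Z R).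
Let nu : probability (X * Z)%type R := (mu \x m)%E.

Let nuX (A : set X) (F : set Z) : measurable A -> measurable F ->
  nu (A `*` F) = (mu A * m F)%E.
Proof. by move=> mA mF; exact: product_measure1E. Qed.

Lemma pi_le1 n a : pi_ n a <= 1.
Proof.
have [h <-] := pi_prob n; rewrite (bigD1 a)//= lerDl.
by apply: sumr_ge0 => c _; exact: h.
Qed.

Lemma pi_ge0 n a : 0 <= pi_ n a.
Proof. by have [h _] := pi_prob n; exact: h. Qed.

(** A word of x on [- k, k] is connected to given letters s and t at - n and n by
    paths of length N; each step of these paths has probability at least
    delta. *)
Lemma bridge_word N (s t : S) k (x : X) :
  (forall (i : int) (a b : S), exists u : int -> S,
    [/\ admissible M i (i + N%:Z) u, u i = a & u (i + N%:Z) = b]) ->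
  let n := (k + N)%N in exists v : int -> S,
  [/\ admissible M (- n%:Z) (- n%:Z + (n + n)%N%:Z) v,
    v (- n%:Z) = s, v (- n%:Z + (n + n)%N%:Z) = t,
    (forall l, - k%:Z <= l -> l <= k%:Z -> v l = sval x l) &
    delta ^+ (N + N) * path_weight P (sval x) (- k%:Z) (k + k) <=
      path_weight P v (- n%:Z) (n + n)].
Proof.
move=> conn n.
have [p [pM ps pe]] := conn (- n%:Z) s (sval x (- k%:Z)).
have [q [qM qs qe]] := conn k%:Z (sval x k%:Z) t.
have e1 : - n%:Z + N%:Z = - k%:Z by lia.
have e2 : - n%:Z + (n + n)%N%:Z = n%:Z by lia.
rewrite e1 in pM pe; rewrite e2.
pose v l := if l <= - k%:Z then p l else if l <= k%:Z then sval x l else q l.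
have vp l : l <= - k%:Z -> v l = p l by move=> h; rewrite /v h.
have vx l : - k%:Z <= l -> l <= k%:Z -> v l = sval x l.
  move=> h1 h2; rewrite /v h2; case: ifP => // h3.
  by rewrite (_ : l = - k%:Z)//; lia.
have vq l : k%:Z <= l -> v l = q l.
  move=> h; have [->|lk] := eqVneq l k%:Z; first by rewrite vx// ?qs//; lia.
  by rewrite /v !ifF//; lia.
have vM : admissible M (- n%:Z) n%:Z v.
  move=> l l1 l2; have [h|h] := ltP l (- k%:Z).
    by rewrite !vp; [apply: pM; lia|lia|lia].
  have [h'|h'] := ltP l k%:Z.
    by rewrite !vx; [exact: shiftspace_step|lia..].
  by rewrite !vq; [apply: qM; lia|lia|lia].
exists v; split=> //.
- by rewrite vp//; lia.
- by rewrite vq -?qe; [congr q; lia|lia].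
have -> : (n + n)%N = (N + ((k + k) + N))%N by lia.
rewrite (path_weight_cat P v (- n%:Z) N) e1 (path_weight_cat P v _ (k + k)).
have e3 : - k%:Z + (k + k)%N%:Z = k%:Z by lia.
rewrite e3 exprD.
have w1 : delta ^+ N <= path_weight P v (- n%:Z) N.
  apply: (path_weight_ge delta0 P_ge) => l l1 l2; apply: vM => //.
  by move: l2; rewrite e1; lia.
have w2 : delta ^+ N <= path_weight P v k%:Z N.
  apply: (path_weight_ge delta0 P_ge) => l l1 l2; apply: vM => //; lia.
have -> : path_weight P v (- k%:Z) (k + k) = path_weight P (sval x) (- k%:Z) (k + k).
  by apply: eq_path_weight => l l1 l2; apply: vx => //; rewrite -e3.
set wx := path_weight _ (sval x) _ _.
have wx0 : 0 <= wx by exact: path_weight_ge0.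
have dN : 0 <= delta ^+ N by rewrite exprn_ge0// ltW.
rewrite -mulrA [delta ^+ N * wx]mulrC.
by apply: ler_pM => //; [exact: mulr_ge0|exact: ler_wpM2l].
Qed.

Variable A : set (X * Z).
Hypothesis mA : measurable A.
Hypothesis swapA : forall i L u v, exchangeable M i (i + L%:Z) u v ->
  nu (A `&` swap_fst i L u v @^-1` (~` A)) = 0%E.

(** The exchange formula with A in place of its preimage under the swap, which
    differs from it by a null set. *)
Lemma window_exchange i L u v F : exchangeable M i (i + L%:Z) u v ->
  measurable F ->
  ((path_weight P v i L)%:E * nu (A `&` (cylinder i (i + L%:Z) u `*` F)) <=
   (path_weight P u i L)%:E * nu (A `&` (cylinder i (i + L%:Z) v `*` F)))%E.
Proof.
move=> uv mF; have [ij uM vM _ _] := uv.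
have mcyl a : admissible M i (i + L%:Z) a ->
    measurable (cylinder i (i + L%:Z) a : set X).
  by move=> aM; exact: measurable_cylinder.
pose E := A `&` (setT `*` F).
have mE : measurable E by apply: measurableI => //; exact: measurableX.
have := swap_exchange P_stoch mu_markov uv m mE; rewrite -/nu.
have -> : E `&` (cylinder i (i + L%:Z) v `*` setT) =
    A `&` (cylinder i (i + L%:Z) v `*` F).
  by apply/seteqP; split=> -[y z]; rewrite /E /=; tauto.
move=> <-; rewrite lee_wpmul2l// ?lee_fin; first exact: path_weight_ge0.
set G := swap_fst _ _ _ _ @^-1` _.
have mG : measurable G.
  apply: measurable_preimage; first exact: measurable_swap_fst.
  by apply: measurableI => //; apply: measurableX => //; exact: mcyl.
pose B := A `&` swap_fst i L u v @^-1` (~` A).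
have mB : measurable B.
  apply: measurableI => //; apply: measurable_preimage.
    exact: measurable_swap_fst.
  exact: measurableC.
apply: (@le_trans _ _ (nu (G `|` B))).
  rewrite le_measure ?inE//.
  - by apply: measurableI => //; apply: measurableX => //; exact: mcyl.
  - exact: measurableU.
  - move=> [y z] [Ay [uy Fz]].
    have [Asy|nAsy] := pselect (A (swap_fst i L u v (y, z))); [left|by right].
    split=> //; split=> //; exact: swap_cyl_left.
apply: (le_trans (measureU2 _ mG mB)).
by rewrite [X in (_ + X)%E](swapA uv) adde0.
Qed.

(** Fix the letters s and t at the ends of a larger window.  Every word of this
    window with these ends can be exchanged with one word v that contains the
    word of x ([bridge_word]).  By [window_exchange] this compares the part of A
    above each word, in proportion to the measure of the word, with the part
    of A above v; the measures of these words sum to that of the event that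
    the ends are s and t, which is at most the initial probability of s.
    Summing over s and t gives the inequality. *)
Lemma ball_independence (c : R) N k (x : X) (F : set Z) :
  (forall (i : int) (a b : S), exists u : int -> S,
    [/\ admissible M i (i + N%:Z) u, u i = a & u (i + N%:Z) = b]) ->
  measurable F ->
  ((delta ^+ (N + N))%:E * (mu (ball_of k x) * nu (A `&` (setT `*` F))) <=
   nu (A `&` (ball_of k x `*` F)))%E.
Proof.
move=> conn mF; pose n := (k + N)%N.
pose i := - n%:Z; pose L := (n + n)%N.
have ball_cyl (y : X) : cylinder i (i + L%:Z) (sval y) = ball_of n y.
  by rewrite /ball_of /i /L; congr cylinder; lia.
pose ends (y : X) : S * S := (sval y i, sval y (i + L%:Z)).
have mends st : measurable (ends @^-1` [set st]).
  apply: (@measurable_ball_invariant _ _ _ _ n) => y z yz /= <-.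
  by rewrite /ends !yz//; lia.
have mball y : measurable (ball_of k y : set X) by exact: measurable_ball.
pose g (p : X * Z) := ends p.1.
have gE st : g @^-1` [set st] = (ends @^-1` [set st]) `*` setT.
  by apply/seteqP; split=> [[y z] //=|[y z] [//]].
have mg st : measurable (g @^-1` [set st]).
  by rewrite gE; exact: measurableX.
have mAF : measurable (A `&` (setT `*` F)).
  by apply: measurableI => //; exact: measurableX.
have mAb : measurable (A `&` (ball_of k x `*` F)).
  by apply: measurableI => //; exact: measurableX.
rewrite (fibre_sum nu mAF mg) (fibre_sum nu mAb mg).
rewrite !ge0_sume_distrr; [|by move=> *; rewrite ?mule_ge0..].
apply: lee_sum => -[s t] _.
have [v [vM vs vt vx wv]] := bridge_word s t k x conn.
rewrite -/n -/i -/L in vM vs vt wv.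
pose V := nu (A `&` (cylinder i (i + L%:Z) v `*` F)).
have mV : measurable (A `&` (cylinder i (i + L%:Z) v `*` F)).
  by apply: measurableI => //; apply: measurableX => //;
    apply: measurable_cylinder => //; lia.
have V0 : (0 <= V)%E by exact: measure_ge0.
have wv0 := path_weight_gt0 delta0 P_ge vM.
apply: (@le_trans _ _ V); last first.
  rewrite le_measure ?inE//; first by apply: measurableI.
  move=> [y z] [Ay [vy Fz]]; split; first split=> //; first split=> //.
    by move=> l l1 l2; rewrite vy ?vx//; lia.
  by rewrite /g /ends /= !vy ?vs ?vt//; lia.
pose W := (A `&` (setT `*` F)) `&` g @^-1` [set (s, t)].
have mW : measurable W by exact: measurableI.
rewrite -/W.
have pw : ((path_weight P v i L)%:E * nu W <= V)%E.
  have mu_ends : (mu (ends @^-1` [set (s, t)]) <= (pi_ i s)%:E)%E.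
    have sM : admissible M i (i + 0%:Z) (fun=> s) by move=> l l1 l2; lia.
    have := mu_cylinder mu_markov sM.
    rewrite /path_weight big_ord0 mulr1 => <-.
    rewrite le_measure ?inE//; first by apply: measurable_cylinder => //; lia.
    by move=> y [ys _] l l1 l2; rewrite (_ : l = i)//; lia.
  (* The initial probability of s turns path weights into measures of balls,
     whose sum is the measure of the event that the ends are s and t. *)
  have [pis|pis] := eqVneq (pi_ i s) 0.
    suff -> : nu W = 0%E by rewrite mule0.
    apply/eqP; rewrite eq_le measure_ge0 andbT.
    apply: (@le_trans _ _ (nu ((ends @^-1` [set (s, t)]) `*` setT))).
      rewrite le_measure ?inE//; first exact: measurableX.
      by rewrite -gE => p [].
    by rewrite nuX// probability_setT mule1; move: mu_ends; rewrite pis.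
  have pis0 : 0 < pi_ i s by rewrite lt_neqAle eq_sym pis pi_ge0.
  have pisE : (0 < (pi_ i s)%:E)%E by rewrite lte_fin.
  rewrite -(@lee_pmul2l _ (pi_ i s)%:E)//.
  apply: (@le_trans _ _ (mu (ends @^-1` [set (s, t)]) * V)%E); last first.
    by rewrite lee_wpmul2r.
  pose h (p : X * Z) := word n p.1.
  have hE w : h @^-1` [set w] = (word n @^-1` [set w]) `*` setT.
    by apply/seteqP; split=> [[y z] //=|[y z] [//]].
  have mh w : measurable (h @^-1` [set w]).
    by rewrite hE; apply: measurableX => //; exact: measurable_word.
  rewrite (fibre_sum nu mW mh).
  rewrite (fibre_sum mu (mends (s, t)) (@measurable_word _ _ _ _ n)).
  rewrite !ge0_sume_distrr; [|by move=> *; rewrite ?mule_ge0// lee_fin ltW..].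
  rewrite ge0_sume_distrl; last by move=> *; exact: measure_ge0.
  apply: lee_sum => w _.
  have [w0|[y yw]] := @word_fibre _ _ S0 prM n w.
    rewrite hE w0 set0X setI0 measure0 !mule0 mule_ge0//.
  rewrite hE yw.
  have [yst|nyst] := pselect (ends y = (s, t)); last first.
    rewrite (_ : W `&` _ = set0) ?measure0 ?mule0 ?mule_ge0//.
    apply/seteqP; split=> // -[y' z] [[_ gy'] [yy' _]]; apply: nyst.
    by rewrite -gy' /g /ends /= !yy'//; lia.
  have uv : exchangeable M i (i + L%:Z) (sval y) v.
    case: yst => ys yt; split=> //; [lia|exact: admissible_sval| |].
      by rewrite ys vs.
    by rewrite yt vt.
  have -> : (ends @^-1` [set (s, t)]) `&` ball_of n y = ball_of n y.
    apply/setIidPr => y' yy'; rewrite /= -yst /ends !yy'//; lia.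
  have muE : mu (ball_of n y) = (pi_ i s * path_weight P (sval y) i L)%:E.
    by rewrite (mu_ball mu_markov) -/i -/L; case: yst => -> _.
  rewrite [X in (_ <= X * _)%E]muE.
  rewrite EFinM -muleA lee_pmul2l//.
  apply: le_trans (window_exchange uv mF).
  rewrite lee_wpmul2l//; first by rewrite lee_fin ltW.
  rewrite ball_cyl; apply: le_measure; rewrite ?inE//.
  - by apply: measurableI => //; apply: measurableX => //; exact: measurable_ball.
  - by apply: measurableI => //; apply: measurableX => //; exact: measurable_ball.
  - by move=> [y' z] [[[Ay [_ Fz]] _] [yy' _]].
apply: le_trans pw; rewrite muleA lee_wpmul2r//.
rewrite (mu_ball mu_markov) -EFinM lee_fin; apply: le_trans wv.
rewrite ler_wpM2l//; first by rewrite exprn_ge0// ltW.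
rewrite ler_piMl ?pi_le1//; exact: path_weight_ge0.
Qed.

End Mixing.

(** * Ergodicity of the product *)

Section Skew.
Context d1 d2 (X : measurableType d1) (Z : measurableType d2) (R : realType).
Variables (mu : probability X R) (m : probability Z R).
Let nu : probability (X * Z)%type R := (mu \x m)%E.

Lemma marginal_measure (A : set (X * Z)) : measurable A ->
  exists m' : {measure set Z -> \bar R},
    forall F, m' F = nu (A `&` (setT `*` F)).
Proof.
move=> mA.
unshelve eexists (pushforward (mrestr nu mA) snd : {measure set Z -> \bar R}).
  exact: measurable_snd.
move=> F; rewrite /pushforward /= /mrestr; congr (nu _).
by rewrite setIC setTX.
Qed.

Lemma product_measure2_unique (E : set (X * Z)) : measurable E ->
  nu E = (\int[m]_z mu (ysection E z))%E.
Proof.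
move=> mE; apply: (product_measure_unique _ (m' := (mu \x^ m)%E)) => //.
by move=> B C mB mC; exact: product_measure2E.
Qed.

(** On the complement of A the domination says that mu (~A)_z = 0 for almost every
    z with respect to the marginal m' of A.  Invariance of A gives
    (~A)_(Q z) = T (~A)_z, so by nonsingularity the set B of those z with a
    non-null section is Q-invariant: if B is null, so is the complement of A,
    and if B is conull, then m', which vanishes on B, is zero. *)
Lemma ergodic_dichotomy (T : borel_aut X) (Q : borel_aut Z) (c : R)
    (A : set (X * Z)) : 0 < c ->
  nonsingular mu T -> ergodic m Q -> measurable A ->
  prod_aut T Q @^-1` A = A ->
  (forall m' : {measure set Z -> \bar R},
    (forall F, m' F = nu (A `&` (setT `*` F))) ->
    forall E, measurable E ->
      (c%:E * (mu \x^ m') E <= nu (A `&` E))%E) ->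
  nu A = 0%E \/ nu (~` A) = 0%E.
Proof.
move=> c0 nsT eQ mA invA dom.
have [m' m'E] := marginal_measure mA.
have mCA := measurableC mA.
pose h z := mu (ysection (~` A) z).
have mh : measurable_fun setT h by exact: measurable_fun_ysection.
have h0 z : (0 <= h z)%E by exact: measure_ge0.
have ih : (\int[m']_z h z = 0)%E.
  have := dom m' m'E _ mCA; rewrite setICr measure0 => le0.
  apply/eqP; rewrite eq_le integral_ge0// andbT.
  have : (c%:E * \int[m']_z h z <= c%:E * 0)%E by rewrite mule0.
  by rewrite lee_pmul2l// lte_fin.
pose B := [set z | h z != 0%E].
have mB : measurable B.
  rewrite (_ : B = ~` (h @^-1` [set 0%E])).
    by apply: measurableC; apply: measurable_preimage.
  by apply/seteqP; split=> z /= /eqP.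
have m'B : m' B = 0%E.
  have : ae_eq m' setT h (cst 0%E).
    apply/(ae_eq_integral_abs m' measurableT mh).
    by under eq_integral do rewrite gee0_abs//.
  move=> [N [mN N0 sN]]; apply/(negligibleP _ mB); exists N; split=> // z Bz.
  by apply: sN => /= /(_ Logic.I) hz; move: Bz; rewrite /B /= hz eqxx.
have hQ z : h (Q z) = 0%E <-> h z = 0%E.
  rewrite /h (_ : ysection (~` A) (Q z) = T @` ysection (~` A) z).
    by apply: nsT; exact: measurable_ysection.
  rewrite image_aut; apply/seteqP.
  have AE x : A (x, Q z) <-> A (aut_inv T x, z).
    by rewrite -[in X in _ <-> X]invA /= aut_invK.
  by split=> x; rewrite /ysection /= !inE /= => nA /AE.
have invB : Q @^-1` B = B.
  apply/seteqP; split=> z /= /eqP nz; apply/eqP => hz; apply: nz; exact/hQ.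
have [B0|CB0] := eQ _ mB invB.
- right; rewrite product_measure2_unique//.
  apply/eqP; rewrite eq_le integral_ge0// andbT.
  suff -> : (\int[m]_z h z = \int[m]_z cst 0 z)%E by rewrite integral0.
  apply: ae_eq_integral => //.
  exists B; split=> // z /= /not_implyP[_ hz]; rewrite /B/=; exact/eqP.
- left; apply/eqP; rewrite eq_le measure_ge0 andbT.
  apply: (@le_trans _ _ (nu ((A `&` (setT `*` B)) `|` (setT `*` ~` B)))).
    rewrite le_measure ?inE//.
    + apply: measurableU; last by apply: measurableX => //; exact: measurableC.
      by apply: measurableI => //; exact: measurableX.
    + move=> [x z] Axz; have [Bz|nBz] := pselect (B z); [left|right] => //.
  apply: (le_trans (measureU2 _ _ _)).
  + by apply: measurableI => //; exact: measurableX.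
  + by apply: measurableX => //; exact: measurableC.
  have nuAB : nu (A `&` (setT `*` B)) = 0%E by rewrite -m'E m'B.
  rewrite [X in (X + _)%E]nuAB add0e.
  rewrite [leLHS]product_measure1E//; last exact: measurableC.
  by rewrite [X in (_ * X)%E]CB0 mule0.
Qed.

End Skew.

Lemma inf_lower_bound (R : realType) (S : finType) (M : rel S)
    (P : int -> S -> S -> R) :
  (forall n a b, 0 <= P n a b) ->
  forall n a b, M a b -> inf [set r | exists n a b, M a b /\ r = P n a b] <= P n a b.
Proof.
move=> P0 n a b Mab; apply: ge_inf; last by exists n, a, b.
by exists 0 => _ [k [s [t [_ ->]]]].
Qed.

Theorem mainTheorem5 (R : realType) (S : finType) (M : rel S)
  (S0 : (0 < #|S|)%N) (prM : primitive M)
  (pi_ : int -> S -> R) (P : int -> S -> S -> R)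
  (pi_prob : forall n : int, prob_vector (pi_ n))
  (P_stoch : forall n : int, row_stochastic (P n))
  (piP : forall (n : int) (b : S), \sum_a pi_ n a * P n a b = pi_ (n + 1) b)
  (P_gt0 : forall (n : int) (a b : S), 0 < P n a b <-> M a b)
  (mu : probability (markov_shift S0 prM) R)
  (mu_markov : markov_measure pi_ P mu)
  (delta_gt0 : 0 < inf [set r | exists n a b, M a b /\ r = P n a b]) :
  nonsingular mu (left_shift S0 prM) -> conservative mu (left_shift S0 prM) ->
  weakly_mixing mu (left_shift S0 prM).
Proof.
move=> nsT cT d' Z m Q _ pQ eQ A mA invA.
have P_ge := inf_lower_bound (M := M) (P_ge0 P_stoch).
set delta := inf _ in delta_gt0 P_ge.
have [N conn] := primitive_path prM.
have swapA i L u v : exchangeable M i (i + L%:Z) u v ->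
    ((mu \x m) (A `&` swap_fst i L u v @^-1` (~` A)) = 0)%E.
  exact: (invariant_swap P_stoch delta_gt0 P_ge mu_markov nsT cT pQ mA invA).
have c0 : 0 < delta ^+ (N + N) by exact: exprn_gt0.
apply: (ergodic_dichotomy c0 nsT eQ mA invA) => m' m'E E mE.
have fin1 : ((mu \x^ m') setT < +oo)%E.
  rewrite -setXTT product_measure2E// m'E.
  rewrite [X in (X * _)%E](probability_setT mu) mul1e.
  apply: (@le_lt_trans _ _ 1%E); last exact: ltry.
  apply: probability_le1; apply: measurableI => //; exact: measurableX.
have fin2 : (mrestr (mu \x m)%E mA setT < +oo)%E.
  apply: (@le_lt_trans _ _ 1%E); last exact: ltry.
  by apply: probability_le1; exact: measurableI.
rewrite -[leRHS]mul1e setIC.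
apply: (@le_measure_ball _ _ S0 prM _ Z R (mu \x^ m')%E (mrestr (mu \x m)%E mA)
  (delta ^+ (N + N)) 1 0%N) => //; first exact: ltW.
move=> n x F _ mF; rewrite mul1e.
rewrite [X in (_ * X <= _)%E](product_measure2E mu m' (measurable_ball n x) mF).
rewrite m'E [leRHS]/= /mrestr [(ball_of n x `*` F) `&` A]setIC.
exact: (ball_independence pi_prob P_stoch delta_gt0 P_ge mu_markov mA swapA).
Qed.
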